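(* Let $q,r\ge2$ be integers, $b=qr$, $\mu=\mu_{q,b}$, and let $\Lambda=r\Lambda(\tau)$ for a regular mapping $\tau$. Then one can find $0<c_1<c_2<1$ such that the following hold. (i) If there exists a strictly increasing sequence $(\alpha_n)_{n\ge1}$ of positive integers satisfying $$\alpha_{n+1}-\mathcal{M}_{\alpha_n}\to\infty\quad\text{and}\quad \sum_{n=1}^\infty c_1^{\,\mathcal{N}^*_{\alpha_n,\alpha_{n+1}}}=\infty,$$ then $\Lambda$ is a spectrum of $L^2(\mu)$. (ii) If $\sum_{n=1}^\infty c_2^{\,\mathcal{L}^*_n}<\infty$, then $\Lambda$ is not a spectrum of $L^2(\mu)$.
   Context: $\mu_{q,b}$ is the unique Borel probability measure $\mu$ on $\mathbb{R}$ satisfying $\mu(E)=\sum_{i=0}^{q-1}\frac1q\,\mu(f_i^{-1}(E))$ for all Borel $E$, where $f_i(x)=b^{-1}(x+i)$. A countable set $\Lambda\subset\mathbb{R}$ is a spectrum of $L^2(\mu)$ if $\{e^{2\pi i\lambda x}:\lambda\in\Lambda\}$ is an orthonormal basis of $L^2(\mu)$. Words: $\Sigma_q=\{0,\dots,q-1\}$; $\Sigma_q^n$ is the set of words of length $n$; $\Sigma_q^0=\{\vartheta\}$ with $\vartheta$ the empty word; $\Sigma_q^*=\bigcup_{n\ge0}\Sigma_q^n$. For a finite or infinite word $\sigma=\sigma_1\sigma_2\cdots$, $\sigma|_k=\sigma_1\cdots\sigma_k$. Juxtaposition is concatenation, $0^k$ is the word of $k$ zeros, $0^\infty=000\cdots$.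 $\Gamma_q=\{\sigma0^\infty:\sigma=\sigma_1\cdots\sigma_k\in\Sigma_q^*,\ \sigma_k\ne0\}$, where $\sigma=\vartheta$ is allowed, so $0^\infty\in\Gamma_q$. Let $\mathcal{C}=\{-1,0,1,\dots,b-2\}$ and $\mathcal{C}_i=(i+q\mathbb{Z})\cap\mathcal{C}$ for $i=0,\dots,q-1$. A map $\tau:\Sigma_q^*\to\mathcal{C}$ is regular on $\sigma\in\Gamma_q$ if $\tau(\sigma|_k)=0$ for all sufficiently large $k$. The map $\tau$ is a regular mapping if (i) $\tau(\vartheta)=\tau(0^n)=0$ for all $n\ge1$; (ii) $\tau(\sigma_1\cdots\sigma_k)\in\mathcal{C}_{\sigma_k}$ for all $k\ge1$ and $\sigma_1\cdots\sigma_k\in\Sigma_q^k$; and $\tau$ is regular on every $\sigma\in\Gamma_q$. For a regular mapping $\tau$ put $\Pi^\tau_b(\sigma)=\sum_{k=1}^\infty\tau(\sigma|_k)b^{k-1}$ for $\sigma\in\Gamma_q$, and $\Lambda(\tau)=\{\Pi^\tau_b(\sigma):\sigma\in\Gamma_q\}$; $r\Lambda(\tau)=\{r\lambda:\lambda\in\Lambda(\tau)\}$. For an integer $n\ge1$ write its $q$-adic expansion $n=\sum_{j=1}^k\sigma_jq^{j-1}$ with $\sigma_j\in\{0,\dots,q-1\}$, $\sigma_k\ne0$, and let $\sigma=\sigma_1\cdots\sigma_k$. Let $N_n\ge k$ be the integer with $\tau(\sigma0^{N_n-k})\ne0$ and $\tau(\sigma0^{\ell})=0$ for all $\ell>N_n-k$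 (it exists, since $\tau(\sigma)\neq0$ by (ii)). Let $N_n^*=\#\{\ell\ge1:\tau(\sigma0^\ell)\ne0\}$. For $m<n$ define $$\mathcal{N}^*_{m,n}=\max\{N^*_k:q^m\le k<q^n\},\qquad \mathcal{L}^*_n=\min\{N_k^*:q^n\le k<q^{n+1}\},\qquad \mathcal{M}_n=\max\{N_k:1\le k<q^n\}.$$ *)

(* Defs.v *)
From HB Require Import structures.
From mathcomp Require Import all_boot all_order all_algebra finmap complex.
From mathcomp Require Import all_classical all_reals all_analysis.
Set Implicit Arguments.
Unset Strict Implicit.
Unset Printing Implicit Defensive.
Import Order.TTheory GRing.Theory Num.Theory.
Import numFieldNormedType.Exports.
Local Open Scope classical_set_scope.
Local Open Scope ring_scope.

(* Uniqueness (and existence) of such a probability measure is classical, so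
   quantifying over all [mu] with this property singles out mu_{q,b}. *)
Definition is_cantor_measure (R : realType) (q b : nat)
    (mu : probability (measurableTypeR R) R) : Prop :=
  forall E : set (measurableTypeR R), measurable E ->
    mu E = (\sum_(i < q)
      (q%:R^-1)%:E * mu ((fun x : R => (b%:R^-1 * (x + i%:R))%R) @^-1` E))%E.

(** * The complex space L^2(mu) and spectra *)

Definition cintegral (d : measure_display) (T : measurableType d)
    (R : realType) (mu : {measure set T -> \bar R}) (f : T -> R[i]) : R[i] :=
  Complex (\int[mu]_(x in setT) complex.Re (f x))
          (\int[mu]_(x in setT) complex.Im (f x)).

Definition L2norm (d : measure_display) (T : measurableType d)
    (R : realType) (mu : {measure set T -> \bar R}) (f : T -> R[i]) : \bar R :=
  Lnorm mu 2%:E (fun x => (Normc.normc (f x))%:E).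

Definition in_L2 (d : measure_display) (T : measurableType d)
    (R : realType) (mu : {measure set T -> \bar R}) (f : T -> R[i]) : Prop :=
  [/\ measurable_fun setT (fun x => complex.Re (f x)),
      measurable_fun setT (fun x => complex.Im (f x)) &
      (L2norm mu f < +oo)%E].

Definition L2inner (d : measure_display) (T : measurableType d)
    (R : realType) (mu : {measure set T -> \bar R}) (f g : T -> R[i]) : R[i] :=
  cintegral mu (fun x => f x * conjc (g x)).

(* Orthonormality of the family also makes distinct indices give distinct
   classes in L^2(mu), so the family may be identified with its range. *)
Definition orthonormal_basis (d : measure_display) (T : measurableType d)
    (R : realType) (mu : {measure set T -> \bar R})
    (I : choiceType) (A : set I) (e : I -> T -> R[i]) : Prop :=
  [/\ forall i, A i -> in_L2 mu (e i),
      forall i j, A i -> A j -> L2inner mu (e i) (e j) = (i == j)%:R &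
      forall f, in_L2 mu f -> forall eps : R, 0 < eps ->
        exists (s : seq I) (c : I -> R[i]),
          (forall i, i \in s -> A i) /\
          (L2norm mu (fun x => f x - \sum_(i <- s) c i * e i x)%R
             < eps%:E)%E].

Definition expi (R : realType) (lambda x : R) : R[i] :=
  Complex (cos (2 * pi * lambda * x)) (sin (2 * pi * lambda * x)).

Definition is_spectrum (R : realType)
    (mu : probability (measurableTypeR R) R) (Lambda : set R) : Prop :=
  countable Lambda /\
  orthonormal_basis mu Lambda (fun lambda : R => expi lambda).

(** * Words *)

(* A finite word sigma_1 ... sigma_k is a sequence [:: sigma_1; ...; sigma_k];
   an infinite word is a function [w] with sigma_j = w j.-1. *)

Definition letter0 (q : nat) (q_gt1 : (1 < q)%N) : 'I_q :=
  Ordinal (ltnW q_gt1).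

Definition zeros (q : nat) (q_gt1 : (1 < q)%N) (n : nat) : seq 'I_q :=
  nseq n (letter0 q_gt1).

(* The empty word is allowed: it has no last letter. *)
Definition last_nonzero (q : nat) (q_gt1 : (1 < q)%N) (s : seq 'I_q) : Prop :=
  s <> [::] -> last (letter0 q_gt1) s <> letter0 q_gt1.

Definition pad0 (q : nat) (q_gt1 : (1 < q)%N) (s : seq 'I_q) : nat -> 'I_q :=
  fun j => nth (letter0 q_gt1) s j.

Definition Gamma (q : nat) (q_gt1 : (1 < q)%N) : set (nat -> 'I_q) :=
  [set pad0 q_gt1 s | s in last_nonzero q_gt1].

(* sigma|_k *)
Definition prefix_word (q : nat) (sigma : nat -> 'I_q) (k : nat) : seq 'I_q :=
  mkseq sigma k.

(** * Regular mappings *)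

Definition digitsC (b : nat) : set int :=
  [set z | (-1 <= z) && (z <= b%:Z - 2)].

Definition digitsCi (q b i : nat) : set int :=
  [set i%:Z + q%:Z * m | m in [set: int]] `&` digitsC b.

Definition regular_on (q : nat) (tau : seq 'I_q -> int)
    (sigma : nat -> 'I_q) : Prop :=
  \forall k \near \oo, tau (prefix_word sigma k) = 0.

Record regular_mapping (q : nat) (q_gt1 : (1 < q)%N) (b : nat)
    (tau : seq 'I_q -> int) : Prop := RegularMapping {
  regular_codomain : forall s, digitsC b (tau s) ;
  regular_nil : tau [::] = 0 ;
  regular_zeros : forall n, (1 <= n)%N -> tau (zeros q_gt1 n) = 0 ;
  regular_digit : forall (s : seq 'I_q) (a : 'I_q),
    digitsCi q b a (tau (rcons s a)) ;
  regular_Gamma : forall sigma, Gamma q_gt1 sigma -> regular_on tau sigma }.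

(* The sum over k >= 1 of tau(sigma|_k) b^(k-1), indexed by k - 1. *)
Definition Pi_tau (R : realType) (q b : nat) (tau : seq 'I_q -> int)
    (sigma : nat -> 'I_q) : R :=
  limn (series (fun k : nat =>
    (tau (prefix_word sigma k.+1))%:~R * b%:R ^+ k : R)).

Definition Lambda_tau (R : realType) (q : nat) (q_gt1 : (1 < q)%N) (b : nat)
    (tau : seq 'I_q -> int) : set R :=
  [set Pi_tau R b tau sigma | sigma in Gamma q_gt1].

Arguments Lambda_tau R {q} q_gt1 b tau.

(** * The counting functions attached to tau *)

Definition is_qadic (q : nat) (q_gt1 : (1 < q)%N) (n : nat)
    (s : seq 'I_q) : Prop :=
  n = (\sum_(j < size s) nth (letter0 q_gt1) s j * q ^ j)%N /\
  last_nonzero q_gt1 s.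

(* [xget] picks the unique element of a set; its first argument is a default
   value, irrelevant here. *)
Definition qadic (q : nat) (q_gt1 : (1 < q)%N) (n : nat) : seq 'I_q :=
  xget [::] [set s | is_qadic q_gt1 n s].

Definition Nlast (q : nat) (q_gt1 : (1 < q)%N) (tau : seq 'I_q -> int)
    (n : nat) : nat :=
  let s := qadic q_gt1 n in
  xget 0%N [set N | [/\ (size s <= N)%N,
    tau (s ++ zeros q_gt1 (N - size s)) <> 0 &
    forall l, (N - size s < l)%N -> tau (s ++ zeros q_gt1 l) = 0]].

(* The set is finite for regular [tau], so [fset_set] is a faithful copy. *)
Definition Nstar (q : nat) (q_gt1 : (1 < q)%N) (tau : seq 'I_q -> int)
    (n : nat) : nat :=
  let s := qadic q_gt1 n in
  #|` fset_set [set l | (1 <= l)%N /\ tau (s ++ zeros q_gt1 l) <> 0]|.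

Definition maxNstar (q : nat) (q_gt1 : (1 < q)%N) (tau : seq 'I_q -> int)
    (m n : nat) : nat :=
  (\max_(q ^ m <= k < q ^ n) Nstar q_gt1 tau k)%N.

(* The seed of [minn] is the value at the first index of the range. *)
Definition minNstar (q : nat) (q_gt1 : (1 < q)%N) (tau : seq 'I_q -> int)
    (n : nat) : nat :=
  \big[minn/Nstar q_gt1 tau (q ^ n)]_(q ^ n <= k < q ^ n.+1)
    Nstar q_gt1 tau k.

Definition maxN (q : nat) (q_gt1 : (1 < q)%N) (tau : seq 'I_q -> int)
    (n : nat) : nat :=
  (\max_(1 <= k < q ^ n) Nlast q_gt1 tau k)%N.

(* Main.v *)
Require Import Defs.
From HB Require Import structures.
From mathcomp Require Import all_boot all_order all_algebra finmap complex.
From mathcomp Require Import all_classical all_reals all_analysis.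
From mathcomp Require Import measurable_realfun ring lra zify.
Import Order.TTheory GRing.Theory Num.Theory.
Import numFieldNormedType.Exports.
Local Open Scope classical_set_scope.
Local Open Scope ring_scope.

(** Let F be the squared modulus of the Fourier transform of mu, and G that of
    its mask polynomial y |-> (1/q) sum_(j < q) e(j y), where
    e(y) = exp(2 i pi y).  Self-similarity of mu reads F x = G (x/b) F (x/b),
    so that F x = P_n x * F (x/b^n), where P_n x is the product of the
    G (x/b^k), 1 <= k <= n.  By the identity [nsq_bessel], an orthonormal
    family of exponentials indexed by Lambda has every exponential in its
    closed span as soon as Q(xi) = sum_(lambda in Lambda) F (xi + lambda)
    equals 1 for all xi, and is not complete as soon as Q(xi) < 1 for one xi.

    The words of Gamma are the q-adic expansions of the integers k; [freq k]
    denotes the element of Lambda attached to k, with digits t k j.  The term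
    r b^j t k j of [freq k] shifts the argument of the factor of index j+1
    of the product by (t k j)/q, and those of the factors before it by
    integers.  As t k j runs over a residue system mod q when the digit of
    index j of k varies, and the values of G on a translate of (1/q)Z
    modulo 1 add up to 1, this gives sum_(k < q^n) P_n (xi + freq k) = 1
    ([partial_weight_sum]) and the orthogonality of the family
    ([freq_orthogonal]).  The part Q_n(xi) of Q(xi) carried by the k < q^n
    thus differs from 1 only through the tails F ((xi + freq k)/b^n).

    The argument of a tail is a point of a fixed compact interval, where F is
    at least some c > 0, moved by digits that are multiples of q.  A zero digit
    only divides the point by b; a nonzero digit restarts the product at
    another point of the interval, which costs at worst a factor c, and moves
    the argument of the next factor into a compact part of ]0, 1/q[, where G is
    at most some c' < 1.  With N nonzero digits the tail lies between c^(N+1)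
    and c'^N ([tail_lower], [tail_upper]).

    For (i), assume Q_n(xi) <= 1 - e for all n.  For n = alpha_m and
    p = alpha_(m+1), the condition on the last nonzero digits makes
    P_p (xi + freq k) close to F (xi + freq k) for k < q^n, so a mass of about e
    is left to the k between q^n and q^p, and Q_p - Q_n is at least a constant
    times c1 to the power maxNstar.  The sum of these increments is at
    most 1 ([weights_summable]).  For (ii), Q_(n+1) - Q_n is at most
    c2^(minNstar n) (1 - Q_n), and 1 - Q_n stays away from 0 once the tail of
    the series is at most 1/2 ([frame_sum_gap]); here xi = 1/b, where every
    Q_n is smaller than 1.

    It remains to see that a closed span which contains all exponentials is the
    whole of L^2(mu) ([approximable_L2]).  The bounded functions that multiply
    this span into itself form an algebra stable under bounded pointwise
    limits.  It contains the sines, hence their signs, hence the indicators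
    of half-lines, of Borel sets, and all bounded measurable functions. *)

Set Implicit Arguments.
Unset Strict Implicit.
Unset Printing Implicit Defensive.

(** * Integer digits *)

Lemma digit_quotient_bounds (q r : nat) (e : int) : (1 < q)%N ->
  q%:Z * e != 0 -> -1 <= q%:Z * e <= (q * r)%:Z - 2 -> 1 <= e <= r%:Z - 1.
Proof.
rewrite PoszM => q1 qe0 /andP[ge_qe qe_le].
have e_ge0 : 0 <= e by rewrite leNgt; apply/negP => e0; nia.
have e_neq0 : e != 0 by apply: contraNneq qe0 => ->; rewrite mulr0.
have lt_er : e < r%:Z by rewrite ltNge; apply/negP => re; nia.
lia.
Qed.

Lemma residue_difference (q a a' : nat) : (a < q)%N -> (a' < q)%N -> a != a' ->
  exists i : nat, exists m : int,
    (0 < i < q)%N /\ a%:Z - a'%:Z = i%:Z + q%:Z * m.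
Proof.
move=> aq aq' /eqP aa'; case: (ltnP a' a) => h.
  exists (a - a')%N, 0; split; first by apply/andP; split; lia.
  by rewrite mulr0 addr0 subzn// ltnW.
exists (q + a - a')%N, (-1); split; first by apply/andP; split; lia.
lia.
Qed.

Lemma norm_digit_le (b : nat) (d : int) : (3 < b)%N ->
  -1 <= d <= b%:Z - 2 -> `|d| <= b%:Z - 2.
Proof. lia. Qed.

(** * The infinite product and its partial products *)

Section weights.

(** G and F stand for the squared moduli of the mask polynomial and of the
    Fourier transform; the properties assumed here are all that the estimates
    on the infinite product depend on. *)
Variables (R : realType) (q r b : nat) (G F : R -> R).
Hypotheses (q_gt1 : (1 < q)%N) (r_gt1 : (1 < r)%N) (b_def : b = (q * r)%N).
Hypothesis G_shift : forall y, G (y + 1) = G y.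
Hypothesis G_sum : forall y, \sum_(i < q) G (y + i%:R / q%:R) = 1.
Hypothesis G_ge0 : forall y, 0 <= G y.
Hypothesis G_gt0 : forall y, `|y| < q%:R^-1 -> 0 < G y.
Hypothesis G_cont : continuous G.
Hypothesis FG : forall x, F x = G (x / b%:R) * F (x / b%:R).
Hypothesis F_cont : continuous F.
Hypothesis F_ge0 : forall x, 0 <= F x.
Hypothesis F_le1 : forall x, F x <= 1.
Hypothesis F0 : F 0 = 1.

Let q0 : 0 < q%:R :> R. Proof. by rewrite ltr0n; lia. Qed.
Let r0 : 0 < r%:R :> R. Proof. by rewrite ltr0n; lia. Qed.
Let b0 : 0 < b%:R :> R. Proof. by rewrite ltr0n; lia. Qed.
Let bE : b%:R = q%:R * r%:R :> R. Proof. by rewrite b_def natrM. Qed.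
Let b_ge4 : (4 <= b)%N. Proof. by nia. Qed.
Let b4 : 4 <= b%:R :> R. Proof. by rewrite ler_nat. Qed.
Let b1 : 1 <= b%:R :> R. Proof. by rewrite (le_trans _ b4)// ler1n. Qed.
Let q2 : 2 <= q%:R :> R. Proof. by rewrite ler_nat. Qed.
Let r2 : 2 <= r%:R :> R. Proof. by rewrite ler_nat. Qed.
Lemma q_neq0 : q%:R != 0 :> R. Proof. by rewrite lt0r_neq0. Qed.
Lemma r_neq0 : r%:R != 0 :> R. Proof. by rewrite lt0r_neq0. Qed.
Lemma b_neq0 : b%:R != 0 :> R. Proof. by rewrite lt0r_neq0. Qed.
Lemma b_sub1_neq0 : b%:R - 1 != 0 :> R. Proof. by rewrite lt0r_neq0// subr_gt0; have := b4; lra. Qed.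
Let bn0 n : 0 < b%:R ^+ n :> R. Proof. exact: exprn_gt0. Qed.

Lemma weight_shift_int y (m : int) : G (y + m%:~R) = G y.
Proof.
have nat_shift z (n : nat) : G (z + n%:R) = G z.
  by elim: n => [|n IH]; rewrite ?addr0// -addn1 natrD addrA G_shift.
case: m => n; first exact: nat_shift.
by rewrite NegzE mulrNz -(nat_shift (y - _) n.+1) subrK.
Qed.

Lemma weight_le1 y : G y <= 1.
Proof.
have q_gt0 := ltnW q_gt1.
rewrite -(G_sum y) (bigD1 (Ordinal q_gt0))//= mul0r addr0 lerDl.
exact: sumr_ge0.
Qed.

Lemma weight0 : G 0 = 1.
Proof. by have := FG 0; rewrite mul0r F0 mulr1. Qed.

(** The term of index 0 already exhausts the sum of the G (i/q). *)
Lemma weight_nat_div (i : nat) : (0 < i < q)%N -> G (i%:R / q%:R) = 0.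
Proof.
move=> /andP[i0 iq]; have q_gt0 := ltnW q_gt1.
have := G_sum 0; rewrite (bigD1 (Ordinal q_gt0))//= mul0r addr0 weight0.
move=> /(canRL (addKr _)); rewrite addNr => /eqP.
rewrite psumr_eq0// => /allP/(_ (Ordinal iq)).
rewrite mem_index_enum => /(_ isT)/implyP.
by rewrite -val_eqE/= -lt0n i0 add0r => /(_ isT)/eqP.
Qed.

(** The point y - 1/q is congruent mod 1 to another point of the translate
    y + (1/q)Z, where G is positive: it takes its share of the total mass 1. *)
Lemma weight_lt1 y : 0 < y < q%:R^-1 -> G y < 1.
Proof.
move=> /andP[y0 yq].
have q_gt0 := ltnW q_gt1.
have qm : (q.-1 < q)%N by rewrite ltn_predL.
have qVE : q.-1%:R / q%:R = 1 - q%:R^-1 :> R.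
  by rewrite -subn1 natrB//; field; rewrite q_neq0.
have h : 0 < G (y - q%:R^-1) by apply: G_gt0; rewrite ltr_norml; apply/andP; lra.
have := G_sum y; rewrite (bigD1 (Ordinal q_gt0))//= mul0r addr0.
rewrite (bigD1 (Ordinal qm))/=; last by rewrite -val_eqE/= -lt0n -ltnS prednK.
have -> : y + q.-1%:R / q%:R = y - q%:R^-1 + 1 by rewrite qVE; ring.
rewrite G_shift; set S := \sum_(_ < _ | _) _ => e.
have S0 : 0 <= S by apply: sumr_ge0.
lra.
Qed.

Ltac lrab := move: q2 r2 b4 q0 r0 b0 b1 => ? ? ? ? ? ? ?; lra.

Definition partial_weight n x := \prod_(k < n) G (x / b%:R ^+ k.+1).
Local Notation P := partial_weight.

Lemma partial_weightS n x : P n.+1 x = P n x * G (x / b%:R ^+ n.+1).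
Proof. by rewrite /P big_ord_recr. Qed.

Lemma F_partial_weight n x : F x = P n x * F (x / b%:R ^+ n).
Proof.
elim: n => [|n IH]; first by rewrite /P big_ord0 mul1r expr0 divr1.
rewrite IH partial_weightS (FG (x / _)) !mulrA.
by rewrite -!(mulrA x) -!invfM -!exprSr.
Qed.

Lemma partial_weight_ge0 n x : 0 <= P n x.
Proof. by apply: prodr_ge0. Qed.

Lemma F_le_partial_weight n x : F x <= P n x.
Proof.
rewrite (F_partial_weight n) -[leRHS]mulr1.
by apply: ler_wpM2l; rewrite ?partial_weight_ge0.
Qed.

(** The shift by a multiple of b^n is an integer in each of the first n factors. *)
Lemma partial_weight_shift n x (m : int) : P n (x + b%:R ^+ n * m%:~R) = P n x.
Proof.
apply: eq_bigr => k _; rewrite mulrDl.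
have -> : b%:R ^+ n * m%:~R / b%:R ^+ k.+1 = (b%:Z ^+ (n - k.+1) * m)%:~R :> R.
  rewrite rmorphM rmorphXn/= -{1}(subnK (ltn_ord k)) exprD.
  rewrite (_ : b%:~R = b%:R)//; field; rewrite lt0r_neq0//.
exact: weight_shift_int.
Qed.

(** * Bounds on a compact interval *)

(** For |x| < r the argument x/b of the first factor, and then all the others,
    lie in the interval ]-1/q, 1/q[ where G does not vanish.  The radius
    r (1 - 1/b) still leaves room for the digits; see [radius_step]. *)
Definition core_radius : R := r%:R * (1 - b%:R^-1).

Lemma b_inv_gt0 : 0 < b%:R^-1 :> R. Proof. by rewrite invr_gt0. Qed.

Lemma F_near1 (e : R) : 0 < e ->
  exists2 d : R, 0 < d & forall x, `|x| < d -> 1 - e < F x.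
Proof.
move=> e0; have /cvgrPdist_lt/(_ e e0) : F x @[x --> (0 : R)] --> (1 : R).
  by rewrite -F0; exact: F_cont.
rewrite -nbhs_nearE -nbhs_ballE => -[d/= d0 dF]; exists d => // x xd.
have := dF x; rewrite /ball/= sub0r normrN => /(_ xd).
by rewrite ltr_norml => /andP[_]; lrab.
Qed.

Lemma norm_div_pow (x : R) n : `|x / b%:R ^+ n| = `|x| / b%:R ^+ n.
Proof. by rewrite normrM normfV (ger0_norm (ltW (bn0 n))). Qed.

Lemma small_power (x d : R) : 0 < d ->
  exists n0, forall n, (n0 <= n)%N -> `|x| / b%:R ^+ n < d.
Proof.
move=> d0.
exists (Num.bound (`|x| / d)) => n nx.
rewrite ltr_pdivrMr ?bn0// mulrC -ltr_pdivrMr//.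
apply: lt_le_trans (archi_boundP (divr_ge0 (normr_ge0 x) (ltW d0))) _.
rewrite -natrX ler_nat (leq_trans nx)// ltnW// ltn_expl//.
exact: leq_trans b_ge4.
Qed.

Lemma partial_weight_gt0 n x : `|x| <= core_radius -> 0 < P n x.
Proof.
move=> xr; apply: prodr_gt0 => k _; apply: G_gt0.
rewrite norm_div_pow ltr_pdivrMr ?bn0//; apply: le_lt_trans xr _.
have : b%:R <= b%:R ^+ k.+1 :> R.
  by rewrite -[leLHS]expr1; apply: ler_weXn2l.
rewrite -(ler_pM2l (x := q%:R^-1)) ?invr_gt0//; apply: lt_le_trans.
rewrite {1}bE mulKf ?lt0r_neq0// /core_radius -[ltRHS]mulr1 ltr_pM2l//.
by rewrite gtrBl b_inv_gt0.
Qed.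

(** The first factors are positive, and the remaining product is close to F 0 = 1. *)
Lemma F_gt0 x : `|x| <= core_radius -> 0 < F x.
Proof.
move=> xr; have [d d0 dF] := F_near1 (@ltr01 R).
have [n0 hn0] := small_power x d0.
rewrite (F_partial_weight n0) mulr_gt0 ?partial_weight_gt0//.
by rewrite -(subrr 1); apply: dF; rewrite norm_div_pow; exact: hn0.
Qed.

Lemma exists_F_lower_bound : exists2 c : R, 0 < c & forall x, `|x| <= core_radius -> c <= F x.
Proof.
have rad0 : 0 <= core_radius.
  by rewrite /core_radius mulr_ge0 ?ler0n// subr_ge0 invf_le1//; lrab.
have := @EVT_min R F (- core_radius) core_radius.
case; first lrab.
  by apply: continuous_subspaceT.
move=> c; rewrite in_itv/= -ler_norml => cr Fc.
exists (F c); first exact: F_gt0.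
by move=> x; rewrite ler_norml => xr; apply: Fc; rewrite in_itv.
Qed.

(** The argument that follows a nonzero digit stays at this distance from both
    ends of the interval [0, 1/q]; see [F_digits_upper]. *)
Definition gap : R := (1 - q%:R^-1) / b%:R.

Lemma exists_weight_upper_bound : exists2 c : R, c < 1 &
  forall y, gap <= y <= q%:R^-1 - gap -> G y <= c.
Proof.
have gap0 : 0 < gap.
  by rewrite /gap divr_gt0// subr_gt0 invf_lt1; lrab.
have gapq : gap <= q%:R^-1 - gap.
  have : q%:R * gap <= 2^-1.
    have -> : q%:R * gap = (1 - q%:R^-1) / r%:R by rewrite /gap bE; field; rewrite ?q_neq0 ?r_neq0//.
    have qV0 : 0 < q%:R^-1 :> R by rewrite invr_gt0.
    by rewrite ler_pdivrMr//; lrab.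
  by move=> ?; rewrite -(ler_pM2l q0) mulrBr mulfV ?lt0r_neq0//; lrab.
have [c] := @EVT_max R G gap (q%:R^-1 - gap) gapq (continuous_subspaceT G_cont).
rewrite in_itv/= => /andP[c1 c2] Gc; exists (G c).
  by apply: weight_lt1; apply/andP; split; lrab.
by move=> y yg; apply: Gc; rewrite in_itv.
Qed.

(** * Arguments moved by digits *)

Definition digit_sum (l : nat) (d : nat -> int) : R :=
  \sum_(j < l) (d j)%:~R * b%:R ^+ j.

Lemma digit_sumS l d :
  digit_sum l.+1 d = (d 0%N)%:~R + b%:R * digit_sum l (fun j => d j.+1).
Proof.
rewrite /digit_sum big_ord_recl expr0 mulr1 big_distrr/=; congr +%R.
by apply: eq_bigr => j _; rewrite /bump/= exprS; ring.
Qed.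

Lemma digit_sum_int l d : exists m : int, digit_sum l d = m%:~R.
Proof.
exists (\sum_(j < l) d j * b%:Z ^+ j); rewrite rmorph_sum/=.
by apply: eq_bigr => j _; rewrite rmorphM rmorphXn.
Qed.

Lemma digit_sum_bound l d (B : R) : (forall j, `|(d j)%:~R| <= B) ->
  `|digit_sum l d| <= B * (b%:R ^+ l - 1) / (b%:R - 1).
Proof.
move=> dB; apply: le_trans (ler_norm_sum _ _ _) _.
have -> : B * (b%:R ^+ l - 1) / (b%:R - 1) = \sum_(j < l) B * b%:R ^+ j.
  rewrite -big_distrr/= subrX1; field; rewrite ?q_neq0 ?r_neq0 ?b_neq0 ?b_sub1_neq0//.
apply: ler_sum => j _; rewrite normrM (ger0_norm (ltW (bn0 j))).
by rewrite ler_wpM2r// ltW.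
Qed.

Definition nonzero_digits (l : nat) (d : nat -> int) : nat :=
  (\sum_(j < l) (d j != 0))%N.

Lemma nonzero_digitsS l d : nonzero_digits l.+1 d =
  ((d 0%N != 0) + nonzero_digits l (fun j => d j.+1))%N.
Proof. by rewrite /nonzero_digits big_ord_recl. Qed.

(** The digits of index at least 1 contribute an integer to the argument of the
    first factor, and so does the digit of index 0 as it is a multiple of q.
    The latter then moves the base point, after division by b. *)
Lemma F_digit_step th l d : (exists e, d 0%N = q%:Z * e) ->
  F (th + r%:R * digit_sum l.+1 d) =
  G (th / b%:R) *
  F ((th / b%:R + (d 0%N)%:~R / q%:R) + r%:R * digit_sum l (fun j => d j.+1)).
Proof.
move=> [e de]; rewrite FG digit_sumS.
have [m mE] := digit_sum_int l (fun j => d j.+1).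
rewrite mE de rmorphM/=.
have -> : (th + r%:R * (q%:~R * e%:~R + b%:R * m%:~R)) / b%:R =
  th / b%:R + e%:~R + r%:R * m%:~R.
  by rewrite mulrDl -addrA; congr +%R; rewrite bE; field; rewrite r_neq0 q_neq0.
have -> : q%:~R * e%:~R / q%:R = e%:~R :> R by rewrite mulrC mulKf ?q_neq0.
congr (_ * _).
by rewrite (_ : _ + _ = th / b%:R + (e + r%:Z * m)%:~R) ?weight_shift_int// rmorphD rmorphM addrA.
Qed.

(** This is where the radius is used: (1 - 1/b)/b + (b - 2)/b is at most
    1 - 1/b, as b (b - 2) <= (b - 1)^2. *)
Lemma radius_step th (d : int) : `|th| <= core_radius -> (`|d| <= b%:Z - 2) ->
  `|th / b%:R + d%:~R / q%:R| <= core_radius.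
Proof.
move=> thr db; apply: le_trans (ler_normD _ _) _.
rewrite !normrM !normfV (ger0_norm (ltW b0)) (ger0_norm (ltW q0)).
have db' : `|d%:~R| <= b%:R - 2 :> R.
  by rewrite -intr_norm -[b%:R]/(b%:Z%:~R) -[2]/(2%:Z%:~R) -rmorphB/= ler_int.
apply: (@le_trans _ _ (core_radius / b%:R + (b%:R - 2) / q%:R)).
  by apply: lerD; rewrite ler_pM2r ?invr_gt0.
rewrite -(ler_pM2r b0) /core_radius mulrDl divfK ?lt0r_neq0//.
have -> : (b%:R - 2) / q%:R * b%:R = r%:R * (b%:R - 2) :> R by rewrite bE; field; rewrite ?q_neq0 ?r_neq0 ?b_neq0 ?b_sub1_neq0//.
have -> : r%:R * (1 - b%:R^-1) * b%:R = r%:R * (b%:R - 1) :> R by field; rewrite ?q_neq0 ?r_neq0 ?b_neq0 ?b_sub1_neq0//.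
rewrite -mulrDr ler_pM2l//; have := b_inv_gt0; lrab.
Qed.

(** A zero digit turns the base point th into th/b and costs the factor
    G (th/b), which is part of the product F th; a nonzero digit
    replaces what remains of F th by the value of F at a new base point. *)
Lemma F_digits_lower c : 0 < c -> (forall x, `|x| <= core_radius -> c <= F x) ->
  forall l d th, `|th| <= core_radius ->
  (forall j, exists e, d j = q%:Z * e) -> (forall j, `|d j| <= b%:Z - 2) ->
  F th * c ^+ nonzero_digits l d <= F (th + r%:R * digit_sum l d).
Proof.
move=> c0 cF; elim=> [|l IH] d th thr dq db.
  by rewrite /nonzero_digits /digit_sum !big_ord0 mulr0 addr0 expr0 mulr1.
rewrite F_digit_step// nonzero_digitsS.
have := IH (fun j => d j.+1) _ (radius_step thr (db 0%N)) (fun j => dq j.+1) (fun j => db j.+1).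
set z := _ / _ + _ => IHz.
apply: le_trans (ler_wpM2l (G_ge0 _) IHz); rewrite mulrA exprD mulrA.
rewrite ler_pM2r ?exprn_gt0//.
have [d0|d0] := eqVneq (d 0%N) 0.
  by rewrite /z d0 expr0 mulr1 mul0r addr0 -FG.
rewrite expr1; apply: ler_pM => //; first exact: ltW.
  by rewrite FG ler_piMr.
exact/cF/radius_step.
Qed.

(** A nonzero digit q e, with 1 <= e <= r - 1, puts the argument of the factor
    after it close to e/b.  The factor G (th/b) is kept in the bound because
    this effect of a digit shows in the next step of the induction only. *)
Lemma F_digits_upper c : 0 <= c ->
  (forall y, gap <= y <= q%:R^-1 - gap -> G y <= c) ->
  forall l d th, `|th| <= core_radius ->
  (forall j, exists e, d j = q%:Z * e) ->
  (forall j, -1 <= d j <= b%:Z - 2) ->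
  F (th + r%:R * digit_sum l d) <= G (th / b%:R) * c ^+ nonzero_digits l d.
Proof.
move=> c0 cG; elim=> [|l IH] d th thr dq db.
  rewrite /nonzero_digits /digit_sum !big_ord0 mulr0 addr0 expr0 mulr1.
  by rewrite FG ler_piMr.
rewrite F_digit_step// nonzero_digitsS ler_wpM2l//.
have db0 := norm_digit_le b_ge4 (db 0%N).
have := IH (fun j => d j.+1) _ (radius_step thr db0) (fun j => dq j.+1) (fun j => db j.+1).
move=> /le_trans; apply; rewrite exprD ler_wpM2r ?exprn_ge0//.
have [|d0] := eqVneq (d 0%N) 0; first by rewrite expr0 weight_le1.
rewrite expr1; apply: cG.
have [e de] := dq 0%N.
have /andP[e1 er] : 1 <= e <= r%:Z - 1.
  by apply: (digit_quotient_bounds q_gt1); rewrite -?b_def -de.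
have {}e1 : 1 <= e%:~R :> R by rewrite ler1z.
have {}er : e%:~R <= r%:R - 1 :> R.
  by rewrite -[r%:R]/(r%:Z%:~R) -[1]/(1%:Z%:~R) -rmorphB/= ler_int.
have -> : (d 0%N)%:~R / q%:R = e%:~R :> R by rewrite de rmorphM/= mulrC mulKf// lt0r_neq0.
have thr' : `|th / b%:R| <= q%:R^-1.
  rewrite normrM normfV (ger0_norm (ltW b0)) ler_pdivrMr// bE mulKf ?lt0r_neq0//.
  apply: le_trans thr _.
  by rewrite /core_radius mulrBr mulr1 gerBl mulr_ge0 ?(ltW r0) ?(ltW b_inv_gt0).
move: thr'; rewrite ler_norml /gap => /andP[h1 h2].
have {2}-> : q%:R^-1 = r%:R / b%:R :> R by rewrite bE; field; rewrite ?q_neq0 ?r_neq0//.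
rewrite -mulrBl !ler_pM2r ?invr_gt0//.
by apply/andP; split; lra.
Qed.

(** * Frequencies of an array of digits *)

Variables (t : nat -> nat -> int) (L : nat -> nat).
Hypothesis t_mod : forall k k' j, (k = k' %[mod q ^ j.+1])%N -> t k j = t k' j.
Hypothesis t_digit : forall k j,
  exists m : int, t k j = ((k %/ q ^ j) %% q)%N%:Z + q%:Z * m.
Hypothesis t_bound : forall k j, -1 <= t k j <= b%:Z - 2.
Hypothesis t_fin : forall k j, (L k <= j)%N -> t k j = 0.
Hypothesis t0 : forall j, t 0 j = 0.

Definition trunc_freq n k : R := r%:R * digit_sum n (t k).
Definition freq k : R := trunc_freq (L k) k.

Lemma digit_sum_cat n l d :
  digit_sum (n + l) d = digit_sum n d + b%:R ^+ n * digit_sum l (fun j => d (n + j)%N).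
Proof.
rewrite /digit_sum big_split_ord/= big_distrr/=; congr +%R.
by apply: eq_bigr => j _; rewrite exprD; ring.
Qed.

Lemma digit_sum_eq0 l d : (forall j, (j < l)%N -> d j = 0) -> digit_sum l d = 0.
Proof. by move=> d0; apply: big1 => j _; rewrite d0// mul0r. Qed.

Lemma freqE n k : (L k <= n)%N -> freq k = trunc_freq n k.
Proof.
move=> Ln; rewrite /freq /trunc_freq -[in RHS](subnKC Ln) digit_sum_cat.
by rewrite (digit_sum_eq0 (l := n - _)) ?mulr0 ?addr0// => j _; rewrite t_fin// leq_addr.
Qed.

Lemma freq_tail p k :
  freq k = trunc_freq p k + b%:R ^+ p * (r%:R * digit_sum (L k) (fun j => t k (p + j)%N)).
Proof.
rewrite (@freqE (p + L k)%N) ?leq_addl// /trunc_freq digit_sum_cat; ring.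
Qed.

(** The terms of index at least n add a multiple of b^n. *)
Lemma partial_weight_freq n k xi : P n (xi + freq k) = P n (xi + trunc_freq n k).
Proof.
rewrite (freq_tail n); have [m ->] := digit_sum_int (L k) (fun j => t k (n + j)%N).
by rewrite (_ : r%:R * m%:~R = (r%:Z * m)%:~R) ?addrA ?partial_weight_shift// rmorphM.
Qed.

Lemma sum_radix n (f : nat -> R) :
  \sum_(0 <= k < q ^ n.+1) f k =
  \sum_(0 <= k < q ^ n) \sum_(i < q) f (k + i * q ^ n)%N.
Proof.
rewrite expnS big_nat_mul exchange_big/= big_mkord; apply: eq_bigr => i _.
by rewrite mulSn -{1}[(i * _)%N]add0n big_addn addnK.
Qed.

(** By induction on n: for a given residue of k mod q^n, the last digit moves
    the argument of the last factor along a translate of (1/q)Z, modulo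
    integers, and leaves the other factors unchanged. *)
Lemma partial_weight_sum n xi : \sum_(0 <= k < q ^ n) P n (xi + freq k) = 1.
Proof.
elim: n => [|n IH].
  by rewrite expn0 big_nat1 /P big_ord0.
rewrite sum_radix -[RHS]IH; apply: eq_big_nat => k /andP[_ kq].
rewrite partial_weight_freq; set x := xi + trunc_freq n k.
have tE (i : 'I_q) : P n.+1 (xi + freq (k + i * q ^ n)%N) =
    P n x * G (x / b%:R ^+ n.+1 + i%:R / q%:R).
  set k' := (k + i * q ^ n)%N.
  rewrite partial_weight_freq.
  have -> : xi + trunc_freq n.+1 k' = x + r%:R * (t k' n)%:~R * b%:R ^+ n.
    rewrite /trunc_freq /digit_sum big_ord_recr/= mulrDr mulrA addrA; congr (_ + _ + _).
    congr (_ * _); apply: eq_bigr => j _; congr (_%:~R * _); apply: t_mod.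
    rewrite /k' -[X in (i * q ^ X)%N](subnK (ltn_ord j)) expnD mulnA addnC.
    by rewrite modnMDl.
  have [m ->] := t_digit k' n.
  have -> : ((k' %/ q ^ n) %% q = i)%N.
    rewrite /k' addnC divnMDl ?expn_gt0 ?(ltnW q_gt1)//.
    by rewrite (divn_small kq) addn0 modn_small.
  rewrite partial_weightS; congr (_ * _).
    rewrite mulrC (_ : r%:R * _ = (r%:Z * (i%:Z + q%:Z * m))%:~R) ?partial_weight_shift//.
    by rewrite rmorphM.
  (* As r b^n / b^(n+1) = 1/q, the digit i + q m contributes i/q + m. *)
  rewrite -[RHS](weight_shift_int _ m); congr G.
  rewrite rmorphD rmorphM/= (_ : i%:~R = i%:R)// (_ : q%:~R = q%:R)// bE exprS.
  field; rewrite ?q_neq0 ?r_neq0 ?expf_neq0 ?mulf_neq0 ?q_neq0 ?r_neq0//.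
by rewrite (eq_bigr _ (fun i _ => tE i)) -big_distrr/= G_sum mulr1.
Qed.

(** The part of the sum of F over xi + Lambda that comes from the k < q^n. *)
Definition frame_sum n xi := \sum_(0 <= k < q ^ n) F (xi + freq k).
Local Notation Q := frame_sum.

Lemma frame_sum_le_weights n p xi :
  Q n xi <= \sum_(0 <= k < q ^ n) P p (xi + freq k).
Proof. by apply: ler_sum => k _; apply: F_le_partial_weight. Qed.

Lemma frame_sum_le1 n xi : Q n xi <= 1.
Proof. by rewrite -(partial_weight_sum n xi) frame_sum_le_weights. Qed.

Lemma frame_sum_cat n p xi : (n <= p)%N ->
  Q p xi = Q n xi + \sum_(q ^ n <= k < q ^ p) F (xi + freq k).
Proof. by move=> np; rewrite /Q [LHS](big_cat_nat (n := q ^ n)) ?leq_pexp2l// ltnW. Qed.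

Lemma frame_sum_mono n p xi : (n <= p)%N -> Q n xi <= Q p xi.
Proof. by move=> np; rewrite (frame_sum_cat _ np) lerDl sumr_ge0. Qed.

Lemma first_digit_difference k l : k != l ->
  exists n, [/\ (k = l %[mod q ^ n])%N &
    (k %/ q ^ n) %% q != (l %/ q ^ n) %% q]%N.
Proof.
move=> kl.
have ex : exists n, (k != l %[mod q ^ n.+1])%N.
  exists (k + l)%N.
  by rewrite !modn_small// (leq_trans (ltn_expl _ q_gt1))// leq_exp2l//; lia.
exists (ex_minn ex); case: ex_minnP => n nd nmin; split.
  case: n nd nmin => [|n] _ nmin; first by rewrite expn0 !modn1.
  by apply/eqP/contraT => /nmin; rewrite ltnn.
apply: contraNneq nd => e; rewrite expnSr.
have qn0 : (0 < q ^ n)%N by rewrite expn_gt0 ltnW.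
have klq : (k = l %[mod q ^ n])%N.
  case: n {e qn0} nmin => [|n] nmin; first by rewrite expn0 !modn1.
  by apply/eqP/contraT => /nmin; rewrite ltnn.
have split_mod x : (x %% (q ^ n * q) = ((x %/ q ^ n) %% q) * q ^ n + x %% q ^ n)%N.
  rewrite {1}(divn_eq x (q ^ n)) {1}(divn_eq (x %/ q ^ n) q) mulnDl -mulnA.
  rewrite (mulnC q) -addnA modnMDl modn_small//.
  have := ltn_pmod (x %/ q ^ n) (ltnW q_gt1); have := ltn_pmod x qn0.
  move: (x %% _)%N (_ %% q)%N => u v h1 h2.
  apply: (@leq_trans (v.+1 * q ^ n)%N); first by rewrite mulSn addnC ltn_add2r.
  by rewrite (mulnC (q ^ n)%N) leq_mul2r h2 orbT.
by rewrite !split_mod e klq.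
Qed.

(** At the first index n where the q-adic digits of k and l differ, the
    difference of the frequencies has a digit u not divisible by q.  The
    factor of index n+1 of F is then G (u/q) = 0. *)
Lemma freq_orthogonal k l : k != l -> F (freq k - freq l) = 0.
Proof.
move=> kl; have [n [eq_n ne_n]] := first_digit_difference kl.
pose N := (n.+1 + (L k + L l))%N.
have q_pos := ltnW q_gt1.
have LkN : (L k <= N)%N by rewrite /N addnCA leq_addr.
have LlN : (L l <= N)%N by rewrite ?/N addnA leq_addl.
rewrite (freqE LkN) (freqE LlN).
have -> : trunc_freq (n.+1 + (L k + L l)) k - trunc_freq (n.+1 + (L k + L l)) l =
   r%:R * digit_sum (n.+1 + (L k + L l)) (fun j => t k j - t l j).
  rewrite /trunc_freq -mulrBr; congr (_ * _); rewrite /digit_sum -sumrB.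
  by apply: eq_bigr => j _; rewrite rmorphB mulrBl.
rewrite digit_sum_cat {1}/digit_sum big_ord_recr/= big1; last first.
  move=> j _; rewrite (_ : t k j = t l j) ?subrr ?mul0r//; apply: t_mod.
  have jn := dvdn_exp2l q (ltn_ord j).
  by rewrite -(modn_dvdm k jn) eq_n modn_dvdm.
have [mk ->] := t_digit k n; have [ml ->] := t_digit l n.
have [i [m [iq im]]] := residue_difference (ltn_pmod _ q_pos) (ltn_pmod _ q_pos) ne_n.
have [m' ->] := digit_sum_int (L k + L l) (fun j => t k (n.+1 + j)%N - t l (n.+1 + j)%N).
rewrite (F_partial_weight n.+1) partial_weightS.
set x := r%:R * _.
suff -> : x / b%:R ^+ n.+1 = i%:R / q%:R + (m + mk - ml + r%:Z * m')%:~R.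
  by rewrite weight_shift_int weight_nat_div// mulr0 mul0r.
have -> : i%:R = (((k %/ q ^ n) %% q)%N%:Z - ((l %/ q ^ n) %% q)%N%:Z - q%:Z * m)%:~R :> R.
  by rewrite im addrK.
rewrite /x add0r !(rmorphD, rmorphB, rmorphM, rmorphN)/= bE !exprS.
rewrite (_ : q%:~R = q%:R)// (_ : r%:~R = r%:R)//.
field; rewrite ?q_neq0 ?r_neq0 ?expf_neq0 ?mulf_neq0 ?q_neq0 ?r_neq0//.
Qed.

(** * Tails of the product *)

Definition tail_nonzeros p k := nonzero_digits (L k) (fun j => t k (p + j)%N).

(** The room left in the radius by the truncated frequencies, which satisfy
    |trunc_freq p k| <= b^p r (b - 2)/(b - 1). *)
Definition slack : R := r%:R / (b%:R * (b%:R - 1)).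

Lemma trunc_freq_bound p k : `|trunc_freq p k| <= r%:R * ((b%:R - 2) * (b%:R ^+ p - 1) / (b%:R - 1)).
Proof.
rewrite /trunc_freq normrM (ger0_norm (ltW r0)) ler_pM2l//.
apply: digit_sum_bound => j.
have db := norm_digit_le b_ge4 (t_bound k j).
by rewrite -intr_norm -[b%:R]/(b%:Z%:~R) -[2]/(2%:Z%:~R) -rmorphB/= ler_int.
Qed.

Lemma tail_radius p k xi : `|xi| / b%:R ^+ p <= slack ->
  `|(xi + trunc_freq p k) / b%:R ^+ p| <= core_radius.
Proof.
move=> xis; rewrite norm_div_pow.
apply: (@le_trans _ _ (slack + r%:R * (b%:R - 2) / (b%:R - 1))).
  apply: (@le_trans _ _ ((`|xi| + `|trunc_freq p k|) / b%:R ^+ p)).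
    by rewrite ler_pM2r ?invr_gt0// ler_normD.
  rewrite mulrDl; apply: lerD => //.
  rewrite ler_pdivrMr//; apply: le_trans (trunc_freq_bound p k) _.
  have -> : r%:R * ((b%:R - 2) * (b%:R ^+ p - 1) / (b%:R - 1)) =
      r%:R * (b%:R - 2) / (b%:R - 1) * (b%:R ^+ p - 1) :> R.
    by field; rewrite b_sub1_neq0.
  apply: ler_wpM2l; last by rewrite gerBl.
  by rewrite divr_ge0 ?mulr_ge0 ?(ltW r0)//; lrab.
rewrite /slack /core_radius le_eqVlt; apply/orP; left; apply/eqP; field.
by rewrite b_neq0 b_sub1_neq0.
Qed.

Lemma tailE p k xi : (xi + freq k) / b%:R ^+ p =
  (xi + trunc_freq p k) / b%:R ^+ p + r%:R * digit_sum (L k) (fun j => t k (p + j)%N).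
Proof. rewrite (freq_tail p); field; by rewrite lt0r_neq0. Qed.

(** The q-adic digits of k of index at least p vanish, hence so do the residues
    of the t k (p + j) mod q. *)
Lemma tail_digit_div p k : (k < q ^ p)%N ->
  forall j, exists e : int, t k (p + j)%N = q%:Z * e.
Proof.
move=> kq j; have [m ->] := t_digit k (p + j)%N; exists m.
rewrite divn_small ?mod0n ?add0r//.
by rewrite (leq_trans kq)// leq_pexp2l ?leq_addr// ltnW.
Qed.

Lemma tail_lower c p k xi : 0 < c -> (forall x, `|x| <= core_radius -> c <= F x) ->
  (k < q ^ p)%N -> `|xi| / b%:R ^+ p <= slack ->
  c * c ^+ tail_nonzeros p k <= F ((xi + freq k) / b%:R ^+ p).
Proof.
move=> c0 cF kq xis; rewrite tailE.
have rad := tail_radius k xis.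
apply: le_trans (F_digits_lower c0 cF _ rad (tail_digit_div kq) _); last first.
  by move=> j; apply: norm_digit_le.
by rewrite ler_pM2r ?exprn_gt0// cF.
Qed.

Lemma tail_upper c p k xi : 0 <= c ->
  (forall y, gap <= y <= q%:R^-1 - gap -> G y <= c) ->
  (k < q ^ p)%N -> `|xi| / b%:R ^+ p <= slack ->
  F ((xi + freq k) / b%:R ^+ p) <= c ^+ tail_nonzeros p k.
Proof.
move=> c0 cG kq xis; rewrite tailE.
have rad := tail_radius k xis.
apply: le_trans (F_digits_upper c0 cG _ rad (tail_digit_div kq) _) _.
  by move=> j; exact: t_bound.
by rewrite ler_piMl ?exprn_ge0// weight_le1.
Qed.

(** * Growth of the frame sums *)

Lemma frame_increment n p xi : (n <= p)%N ->
  \sum_(q ^ n <= k < q ^ p) P p (xi + freq k) =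
  1 - \sum_(0 <= k < q ^ n) P p (xi + freq k).
Proof.
move=> np; rewrite -(partial_weight_sum p xi).
rewrite [X in X - _](big_cat_nat (n := q ^ n)%N) ?leq_pexp2l//=; last exact: ltnW.
by rewrite addrAC subrr add0r.
Qed.

Lemma freq_bound k M : (forall j, (M <= j)%N -> t k j = 0) ->
  `|freq k| <= r%:R * b%:R ^+ M.
Proof.
move=> tM; have -> : freq k = trunc_freq M k.
  rewrite (freq_tail M) [X in _ * (_ * X)]digit_sum_eq0 ?mulr0 ?addr0// => j _.
  by rewrite tM// leq_addr.
apply: le_trans (trunc_freq_bound M k) _; rewrite ler_pM2l//.
rewrite ler_pdivrMr; last by lrab.
rewrite mulrC; apply: ler_pM; rewrite ?subr_ge0 ?exprn_ege1//; lrab.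
Qed.

(** Notation in this part: [a] is the sequence alpha, [M n] bounds the last
    nonzero digits of the k < q^(a n), and [w n] bounds the number of nonzero
    digits in the tails of the block q^(a n) <= k < q^(a n.+1). *)
Section divergence.
Variables (c c1 e : R) (xi : R) (a M w : nat -> nat).
Hypotheses (c_gt0 : 0 < c) (F_ge : forall x, `|x| <= core_radius -> c <= F x).
Hypotheses (c1_gt0 : 0 < c1) (c1_le : c1 <= c).
Hypothesis e_gt0 : 0 < e.
Hypothesis frame_le : forall n, frame_sum n xi <= 1 - e.
Hypothesis a_mono : forall n, (1 <= n)%N -> (a n < a n.+1)%N.
Hypothesis a_far : forall K, exists n1, forall n, (n1 <= n)%N -> (M n + K <= a n.+1)%N.
Hypothesis M_last : forall n k j, (1 <= n)%N -> (k < q ^ a n)%N -> (M n <= j)%N -> t k j = 0.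
Hypothesis w_ge : forall n k, (1 <= n)%N -> (q ^ a n <= k < q ^ a n.+1)%N ->
  (tail_nonzeros (a n.+1) k <= w n)%N.

(** The weights P_p (xi + freq k) of the k < q^(a n), with p = a n.+1, are F
    divided by a value of F near 0, as |freq k| <= r b^(M n) is small compared
    with b^p.  They add up to at most (1 - e)/(1 - e/2) <= 1 - e/2, which
    leaves a mass e/2 to the k of the block. *)
Lemma frame_increment_lower : exists2 n1, (1 <= n1)%N & forall n, (n1 <= n)%N ->
  c * (e / 2) * c1 ^+ w n <= frame_sum (a n.+1) xi - frame_sum (a n) xi.
Proof.
have e_le1 : e <= 1.
  have := frame_le 0; have : 0 <= frame_sum 0 xi by apply: sumr_ge0.
  lra.
have c_le1 : c <= 1.
  rewrite -F0 F_ge// normr0 /core_radius mulr_ge0 ?(ltW r0)// subr_ge0.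
  by rewrite invf_le1.
have [d d0 Fd] := F_near1 (divr_gt0 e_gt0 (ltr0Sn _ 1)).
have [K1 hK1] := small_power (`|xi| + r%:R) d0.
have slack0 : 0 < slack by rewrite /slack divr_gt0// mulr_gt0//; lrab.
have [K2 hK2] := small_power xi slack0.
have [n1 hn1] := a_far (K1 + K2).
exists n1.+1 => // n n1n; set p := a n.+1.
have n_ge1 : (1 <= n)%N by apply: leq_trans n1n.
have anp : (a n <= p)%N by rewrite ltnW// a_mono.
have Mp : (M n + (K1 + K2) <= p)%N by apply: hn1; rewrite ltnW.
have xis : `|xi| / b%:R ^+ p <= slack 
  by apply/ltW/hK2/(leq_trans _ Mp); rewrite addnA leq_addl.
have sumP : \sum_(0 <= k < q ^ a n) P p (xi + freq k) <= 1 - e / 2.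
  have le_Q : (1 - e / 2) * \sum_(0 <= k < q ^ a n) P p (xi + freq k) <= frame_sum (a n) xi.
    rewrite big_distrr/=; apply: ler_sum_nat => k /andP[_ kq].
    rewrite (F_partial_weight p) mulrC ler_wpM2l ?partial_weight_ge0//.
    apply/ltW/Fd; rewrite norm_div_pow.
    have Mle : (M n <= p)%N by rewrite (leq_trans _ Mp)// leq_addr.
    have := hK1 (p - M n)%N; rewrite (ger0_norm (addr_ge0 (normr_ge0 _) (ltW r0))).
    have K1p : (K1 <= p - M n)%N.
      by rewrite leq_subRL// (leq_trans _ Mp)// leq_add2l leq_addr.
    move=> /(_ K1p); apply: le_lt_trans.
    rewrite -[in leLHS](subnK Mle) exprD invfM mulrA ler_pdivrMr//.
    apply: (@le_trans _ _ (`|xi| / b%:R ^+ (p - M n) + r%:R * b%:R ^+ M n / b%:R ^+ (p - M n))).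
      rewrite -mulrDl ler_pM2r ?invr_gt0//; apply: le_trans (ler_normD _ _) _.
      by rewrite lerD2l freq_bound// => j; apply: M_last kq.
    rewrite mulrDl mulrDl; apply: lerD; last by rewrite mulrAC.
    by apply: ler_peMr; rewrite ?exprn_ege1// divr_ge0// ltW.
  have := frame_le (a n); set S := bigop _ _ _ in le_Q *.
  by move=> ?; nra.
rewrite (frame_sum_cat _ anp) addrC addKr.
apply: (@le_trans _ _ (\sum_(q ^ a n <= k < q ^ p) (c * c1 ^+ w n) * P p (xi + freq k))).
  rewrite -big_distrr/= (frame_increment _ anp) mulrAC.
  rewrite ler_pM2l; last by rewrite mulr_gt0// exprn_gt0.
  by lra.
apply: ler_sum_nat => k kq; rewrite (F_partial_weight p) mulrC.
rewrite ler_wpM2l ?partial_weight_ge0//.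
have /andP[_ kp] := kq.
apply: le_trans (tail_lower c_gt0 F_ge kp xis); rewrite ler_pM2l//.
apply: (@le_trans _ _ (c ^+ w n)); first by apply: lerXn2r; rewrite ?nnegrE ?(ltW c1_gt0) ?(ltW c_gt0).
by apply: ler_wiXn2l; rewrite ?(ltW c_gt0)// w_ge.
Qed.

(** The increments telescope, and the frame sums stay in [0, 1]. *)
Lemma weights_summable : exists C, forall N, \sum_(1 <= n < N) c1 ^+ w n <= C.
Proof.
have [n1 n1_ge1 incr] := frame_increment_lower.
have ce : 0 < c * (e / 2) by rewrite mulr_gt0// divr_gt0.
pose S := \sum_(1 <= n < n1) c1 ^+ w n.
exists (S + (c * (e / 2))^-1) => N.
have part m : c * (e / 2) * (\sum_(1 <= n < n1 + m) c1 ^+ w n - S) <=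
    frame_sum (a (n1 + m)) xi - frame_sum (a n1) xi.
  elim: m => [|m IH]; first by rewrite addn0 !subrr mulr0.
  rewrite addnS big_nat_recr/=; last by rewrite (leq_trans n1_ge1)// leq_addr.
  have := incr (n1 + m)%N (leq_addr _ _); move: IH; rewrite -/S.
  set u := \sum_(_ <= _ < _) _; move: (frame_sum _ _) (frame_sum _ _) (frame_sum _ _) => x y z.
  by set v := c * (e / 2); move=> IH h; rewrite addrAC mulrDr; lra.
apply: (@le_trans _ _ (\sum_(1 <= n < n1 + N) c1 ^+ w n)).
  case: N => [|N]; first by rewrite big_geq// sumr_ge0// => *; rewrite exprn_ge0 ?ltW.
  rewrite [leRHS](big_cat_nat (n := N.+1))//= ?leq_addl// lerDl.
  by rewrite sumr_ge0// => *; rewrite exprn_ge0 ?ltW.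
rewrite -lerBlDl -[leRHS]mulr1 ler_pdivlMl//; apply: le_trans (part N) _.
have := frame_sum_le1 (a (n1 + N)) xi.
have : 0 <= frame_sum (a n1) xi by apply: sumr_ge0.
lra.
Qed.

End divergence.

Lemma F_lt1 x : 0 < x / b%:R < q%:R^-1 -> F x < 1.
Proof. by move=> x0; apply: le_lt_trans (weight_lt1 x0); rewrite FG ler_piMr. Qed.

(** Here w n is a lower bound for the number of nonzero digits in the tails of
    the k between q^n and q^n.+1. *)
Section convergence.
Variables (c : R) (w : nat -> nat).
Hypotheses (c_ge0 : 0 <= c) (c_lt1 : c < 1).
Hypothesis G_le : forall y, gap <= y <= q%:R^-1 - gap -> G y <= c.
Hypothesis w_le : forall n k, (q ^ n <= k < q ^ n.+1)%N ->
  (w n <= tail_nonzeros n.+1 k)%N.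
Local Notation xi := (b%:R^-1 : R).

Lemma xi_slack p : (0 < p)%N -> `|xi| / b%:R ^+ p <= slack.
Proof.
move=> p0; rewrite ger0_norm ?(ltW b_inv_gt0)// /slack.
apply: (@le_trans _ _ (b%:R^-1 / b%:R)).
  rewrite ler_pM2l ?b_inv_gt0// lef_pV2 ?posrE//.
  by rewrite -[leLHS]expr1 ler_weXn2l.
rewrite mulrC invfM mulrCA ler_pM2l ?b_inv_gt0// ler_pdivlMr; last by lrab.
rewrite mulrBr mulr1 mulVf ?b_neq0//; have := b_inv_gt0; lrab.
Qed.

(** The new weights add up to 1 minus the old ones, and the old weights are at
    least the old values of F. *)
Lemma frame_increment_upper n :
  frame_sum n.+1 xi - frame_sum n xi <= c ^+ w n * (1 - frame_sum n xi).
Proof.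
have nn1 := leqnSn n.
rewrite (frame_sum_cat _ nn1) addrC addKr.
apply: (@le_trans _ _ (\sum_(q ^ n <= k < q ^ n.+1) c ^+ w n * P n.+1 (xi + freq k))).
  apply: ler_sum_nat => k kq; rewrite (F_partial_weight n.+1) mulrC.
  rewrite ler_wpM2r ?partial_weight_ge0//.
  have /andP[_ kp] := kq.
  apply: le_trans (tail_upper c_ge0 G_le kp (xi_slack _)) _ => //.
  by apply: ler_wiXn2l; rewrite ?(ltW c_lt1)// w_le.
rewrite -big_distrr/= (frame_increment _ nn1) ler_wpM2l ?exprn_ge0//.
by rewrite lerB// frame_sum_le_weights.
Qed.

Lemma freq0 : freq 0 = 0.
Proof. by rewrite /freq /trunc_freq digit_sum_eq0 ?mulr0. Qed.

(** In the comparison with the sum of the weights, the term of index 0 is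
    strictly smaller: its tail is F at a nonzero point close to 0. *)
Lemma frame_sum_lt1 n : frame_sum n xi < 1.
Proof.
have q_pos : (0 < q ^ n)%N by rewrite expn_gt0 ltnW.
apply: (@lt_le_trans _ _ (\sum_(0 <= k < q ^ n) P n (xi + freq k))); last first.
  by rewrite partial_weight_sum.
rewrite /frame_sum !(big_ltn q_pos).
apply: ltr_leD; last by apply: ler_sum => k _; apply: F_le_partial_weight.
rewrite freq0 addr0 (F_partial_weight n) -[ltRHS]mulr1 ltr_pM2l.
  apply: F_lt1; rewrite !divr_gt0 ?b_inv_gt0//= -mulrA -invfM -exprSr.
  rewrite -invfM ltf_pV2 ?posrE ?mulr_gt0//.
  apply: (@lt_le_trans _ _ (b%:R * 1)).
    by rewrite mulr1 bE ltr_pMr// ltr1n.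
  by rewrite ler_pM2l// exprn_ege1.
apply: partial_weight_gt0; rewrite ger0_norm ?(ltW b_inv_gt0)// /core_radius.
have : b%:R^-1 <= 2^-1 :> R by rewrite lef_pV2 ?posrE//; lrab.
move=> bV; apply: (@le_trans _ _ (2 * (1 - b%:R^-1))); first by lra.
by rewrite ler_wpM2r// subr_ge0; lra.
Qed.

(** By induction, 1 - Q_(n0+m) is at least (1 - Q_n0)(1 - S), where S is the
    sum of the c^(w n) for n0 <= n < n0 + m: this is the inequality
    (1 - S)(1 - v) >= 1 - (S + v) for S, v >= 0. *)
Lemma frame_sum_gap n0 : (forall N, \sum_(n0 <= n < N) c ^+ w n <= 2^-1) ->
  exists2 d : R, 0 < d & forall n, frame_sum n xi <= 1 - d.
Proof.
move=> small; pose d := 1 - frame_sum n0 xi.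
have d0 : 0 < d by rewrite subr_gt0 frame_sum_lt1.
exists (d / 2); first by rewrite divr_gt0.
have cw0 n : 0 <= c ^+ w n by rewrite exprn_ge0.
have part m : d * (1 - \sum_(n0 <= n < n0 + m) c ^+ w n) <= 1 - frame_sum (n0 + m) xi.
  elim: m => [|m IH]; first by rewrite addn0 big_geq// subr0 mulr1.
  rewrite addnS big_nat_recr/= ?leq_addr//.
  have := frame_increment_upper (n0 + m).
  have S0 : 0 <= \sum_(n0 <= n < n0 + m) c ^+ w n by apply: sumr_ge0.
  have c1 : c ^+ w (n0 + m) <= 1 by rewrite exprn_ile1// ltW.
  move: IH (cw0 (n0 + m)%N) c1 S0; set S := \sum_(_ <= _ < _) _.
  move: (frame_sum _ _) (frame_sum _ _) (c ^+ _) => x y v IH v0 v1 S0 h.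
  have h1 : (1 - v) * (d * (1 - S)) <= (1 - v) * (1 - y) by rewrite ler_wpM2l// subr_ge0.
  have h2 : 0 <= d * (v * S) by rewrite !mulr_ge0// ltW.
  lra.
move=> n; apply: le_trans (frame_sum_mono _ (leq_addl n0 n)) _.
have := part n; have := small (n0 + n)%N.
move: (\sum_(_ <= _ < _) _) (frame_sum _ _) => S x ? ?.
nra.
Qed.

End convergence.

End weights.

(** * The exponential function and the mask polynomial *)

Arguments conjc {R} x : simpl never.

Section cis.
Variable R : realType.
Implicit Types (u v x y : R) (z w : R[i]).

Lemma cvg_sqr (f : R -> R) y (a : R) :
  f x @[x --> y] --> a -> f x ^+ 2 @[x --> y] --> a ^+ 2.
Proof. by move=> fa; exact: (cvgM fa fa). Qed.

Lemma cvg_continuous (h f : R -> R) y (a : R) : continuous h ->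
  f x @[x --> y] --> a -> h (f x) @[x --> y] --> h a.
Proof. by move=> hc fa; exact: (cvg_comp _ _ fa (hc a)). Qed.

Definition cis u : R[i] := Complex (cos (2 * pi * u)) (sin (2 * pi * u)).
(* Keeps conjugated exponentials folded under simplification. *)
Arguments cis : simpl never.

Definition sqn z : R := complex.Re z ^+ 2 + complex.Im z ^+ 2.

Lemma expi_cis u x : expi u x = cis (u * x).
Proof. by rewrite /expi /cis !mulrA. Qed.

Lemma cisD u v : cis (u + v) = cis u * cis v.
Proof. by rewrite /cis mulrDr cosD sinD; congr Complex; ring. Qed.

Lemma cis0 : cis 0 = 1.
Proof. by rewrite /cis mulr0 cos0 sin0. Qed.

Lemma cisN u : cis (- u) = conjc (cis u).
Proof. by rewrite /cis mulrN cosN sinN. Qed.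

Lemma cis1 : cis 1 = 1.
Proof. by rewrite /cis mulr1 mulrC mulr_natr cos2pi sin2pi. Qed.

Lemma cisMn u n : cis (u * n%:R) = cis u ^+ n.
Proof.
elim: n => [|n IH]; first by rewrite mulr0 cis0 expr0.
by rewrite exprS -IH -cisD; congr cis; rewrite -natr1; ring.
Qed.

Lemma cis_nat n : cis n%:R = 1.
Proof. by rewrite -[n%:R]mul1r cisMn cis1 expr1n. Qed.

(** If cos (2 pi u) = 1 then sin (pi u) = 0, whereas sin is positive on
    ]0, pi[. *)
Lemma cis_eq1 u : `|u| < 1 -> cis u = 1 -> u = 0.
Proof.
move=> u1 [cosu _]; apply/eqP; apply: contraT => u0.
have pu : 0 < (pi : R) * `|u| < pi.
  by rewrite mulr_gt0 ?pi_gt0 ?normr_gt0//= gtr_pMr ?pi_gt0.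
have := sin_gt0_pi pu; rewrite lt0r => /andP[/negP[]].
have : cos (pi * `|u| *+ 2) = 1.
  by rewrite -cosu -[RHS]cos_norm !normrM normr_nat (ger0_norm (pi_ge0 R)) -mulr_natl mulrA.
rewrite cos_mulr2n cos2sin2 => h.
have : sin (pi * `|u|) ^+ 2 = 0 by move: h; rewrite mulr2n; lra.
by move/eqP; rewrite sqrf_eq0.
Qed.

Lemma sqnM z w : sqn (z * w) = sqn z * sqn w.
Proof. by case: z => a b; case: w => c d; rewrite /sqn /=; ring. Qed.

Lemma sqn_conj z : sqn (conjc z) = sqn z.
Proof. by case: z => a b; rewrite /conjc /sqn /= sqrrN. Qed.

Lemma sqn_cis u : sqn (cis u) = 1.
Proof. by rewrite /sqn /cis /= cos2Dsin2. Qed.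

Lemma sqn_ge0 z : 0 <= sqn z.
Proof. by rewrite addr_ge0 ?sqr_ge0. Qed.

Lemma sqn_eq0 z : sqn z = 0 -> z = 0.
Proof.
case: z => a b /eqP; rewrite /sqn paddr_eq0 ?sqr_ge0//= !sqrf_eq0.
by move=> /andP[/eqP-> /eqP->].
Qed.

Lemma sqnE z : (sqn z)%:C%C = z * conjc z.
Proof. by case: z => a b; rewrite /conjc /sqn/=; congr Complex => /=; ring. Qed.

Lemma cReD z w : complex.Re (z + w) = complex.Re z + complex.Re w.
Proof. by case: z => a b; case: w. Qed.

Lemma cImD z w : complex.Im (z + w) = complex.Im z + complex.Im w.
Proof. by case: z => a b; case: w. Qed.

Lemma cReM z w : complex.Re (z * w) = complex.Re z * complex.Re w - complex.Im z * complex.Im w.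
Proof. by case: z => a b; case: w. Qed.

Lemma cImM z w : complex.Im (z * w) = complex.Re z * complex.Im w + complex.Im z * complex.Re w.
Proof. by case: z => a b; case: w. Qed.

Lemma cRe_sum (I : Type) (s : seq I) (f : I -> R[i]) :
  complex.Re (\sum_(i <- s) f i) = \sum_(i <- s) complex.Re (f i).
Proof. exact: (big_morph _ cReD). Qed.

Lemma cIm_sum (I : Type) (s : seq I) (f : I -> R[i]) :
  complex.Im (\sum_(i <- s) f i) = \sum_(i <- s) complex.Im (f i).
Proof. exact: (big_morph _ cImD). Qed.

Lemma sqn_sum (I : Type) (s : seq I) (f : I -> R[i]) :
  (sqn (\sum_(i <- s) f i))%:C%C = \sum_(i <- s) \sum_(j <- s) f i * conjc (f j).
Proof.
rewrite sqnE rmorph_sum/= big_distrl/=; apply: eq_bigr => i _.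
by rewrite big_distrr.
Qed.

Definition mask_poly (q : nat) y : R[i] := (q%:R^-1)%:C%C * \sum_(j < q) cis (j%:R * y).

Section mask_theory.
Variable q : nat.
Hypothesis q_gt1 : (1 < q)%N.

Let q0 : q%:R != 0 :> R.
Proof. by rewrite pnatr_eq0 -lt0n ltnW. Qed.

Lemma mask_shift y : sqn (mask_poly q (y + 1)) = sqn (mask_poly q y).
Proof.
congr (sqn (_ * _)); apply: eq_bigr => j _.
by rewrite mulrDr mulr1 cisD cis_nat mulr1.
Qed.

(** A geometric sum with ratio a q-th root of unity, different from 1 if j <> k. *)
Lemma sum_roots_of_unity (j k : 'I_q) : 
  \sum_(i < q) cis ((j%:R - k%:R) * (i%:R / q%:R)) = (if j == k then q%:R else 0).
Proof.
case: eqVneq => [->|jk].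
  rewrite (eq_bigr (fun _ => 1)) ?sumr_const ?card_ord// => i _.
  by rewrite subrr mul0r cis0.
pose om := cis ((j%:R - k%:R) / q%:R).
have omE (i : 'I_q) : cis ((j%:R - k%:R) * (i%:R / q%:R)) = om ^+ i.
  by rewrite -cisMn; congr cis; ring.
rewrite (eq_bigr _ (fun i _ => omE i)); apply/eqP.
have om1 : om - 1 != 0.
  rewrite subr_eq0; apply: contra_neq jk => /cis_eq1 h.
  have small : `|(j%:R - k%:R) / q%:R| < 1 :> R.
    rewrite normrM normfV (ger0_norm (ler0n _ _)) ltr_pdivrMr; last first.
      by rewrite ltr0n ltnW.
    have := ltn_ord j; have := ltn_ord k; rewrite -!(ltr_nat R) mul1r ltr_norml => ? ?.
    have := ler0n R j; have := ler0n R k => ? ?.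
    by apply/andP; split; lra.
  have /eqP := h small; rewrite mulf_eq0 invr_eq0 (negPf q0) orbF subr_eq0 eqr_nat.
  by move=> /eqP ?; apply: val_inj.
rewrite -(mulrI_eq0 _ (mulfI om1)) -subrX1 -cisMn divfK//.
by rewrite cisD cisN !cis_nat conjc1 mulr1 subrr.
Qed.

(** Parseval's identity on Z/qZ: expand the squares and sum over i first. *)
Lemma mask_sum y : \sum_(i < q) sqn (mask_poly q (y + i%:R / q%:R)) = 1.
Proof.
have -> : \sum_(i < q) sqn (mask_poly q (y + i%:R / q%:R)) =
    (q%:R^-1) ^+ 2 * \sum_(i < q) sqn (\sum_(j < q) cis (j%:R * (y + i%:R / q%:R))).
  rewrite big_distrr/=; apply: eq_bigr => i _; rewrite sqnM; congr (_ * _).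
  by rewrite /sqn/= expr0n/= addr0.
suff -> : \sum_(i < q) sqn (\sum_(j < q) cis (j%:R * (y + i%:R / q%:R))) = q%:R ^+ 2.
  by rewrite -exprMn mulVf// expr1n.
apply: (@complexI R); rewrite rmorph_sum/=.
under eq_bigr do rewrite sqn_sum.
rewrite exchange_big/=.
have inner (j : 'I_q) : \sum_(i < q) \sum_(k < q)
   cis (j%:R * (y + i%:R / q%:R)) * conjc (cis (k%:R * (y + i%:R / q%:R))) = q%:R.
  rewrite exchange_big/= (bigD1 j)//= [X in _ + X]big1 => [|k kj].
    rewrite addr0 -[RHS](_ : \sum_(i < q) 1 = _); last by rewrite sumr_const card_ord.
    by apply: eq_bigr => i _; rewrite -cisN -cisD subrr cis0.
  transitivity (\sum_(i < q) cis ((j%:R - k%:R) * y) * cis ((j%:R - k%:R) * (i%:R / q%:R))).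
    by apply: eq_bigr => i _; rewrite -cisN -!cisD; congr cis; ring.
  by rewrite -big_distrr/= sum_roots_of_unity eq_sym (negPf kj) mulr0.
rewrite (eq_bigr _ (fun j _ => inner j)) sumr_const card_ord -[LHS]mulr_natr.
by rewrite rmorphXn/= rmorph_nat expr2.
Qed.

Lemma mask0 : mask_poly q 0 = 1.
Proof.
rewrite /mask_poly (eq_bigr (fun=> 1)) => [|j _]; last by rewrite mulr0 cis0.
by rewrite sumr_const card_ord -(rmorph_nat (real_complex R)) -rmorphM/= mulVf.
Qed.

(** The geometric sum of the mask vanishes only if e(q y) = 1; for |q y| < 1
    this forces y = 0, where the mask is 1. *)
Lemma mask_gt0 y : `|y| < q%:R^-1 -> 0 < sqn (mask_poly q y).
Proof.
move=> yq; rewrite lt0r sqn_ge0 andbT; apply/eqP => /sqn_eq0 m0.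
have q_pos : 0 < q%:R :> R by rewrite ltr0n ltnW.
have sum0 : \sum_(j < q) cis y ^+ j = 0.
  have -> : \sum_(j < q) cis y ^+ j = q%:R%:C%C * mask_poly q y.
    rewrite /mask_poly mulrA -rmorphM/= mulfV// mul1r; apply: eq_bigr => j _.
    by rewrite -cisMn mulrC.
  by rewrite m0 mulr0.
have : cis (y * q%:R) = 1.
  by apply/eqP; rewrite cisMn -subr_eq0 subrX1 sum0 mulr0.
move=> /cis_eq1; rewrite normrM (ger0_norm (ler0n _ _)) -ltr_pdivlMr// mul1r.
move=> /(_ yq)/eqP; rewrite mulf_eq0 (negPf q0) orbF => /eqP y0.
by move: m0; rewrite y0 mask0 => /eqP; rewrite oner_eq0.
Qed.

Lemma mask_continuous : continuous (fun y => sqn (mask_poly q y)).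
Proof.
have -> : (fun y => sqn (mask_poly q y)) = (fun y =>
    q%:R^-1 ^+ 2 * ((\sum_(j < q) cos (2 * pi * (j%:R * y))) ^+ 2 +
                    (\sum_(j < q) sin (2 * pi * (j%:R * y))) ^+ 2)).
  apply/funext => y; rewrite sqnM; congr (_ * _); first by rewrite /sqn/= expr0n addr0.
  by rewrite /sqn cRe_sum cIm_sum.
have lin (j : nat) y : (fun x => 2 * pi * (j%:R * x)) z @[z --> y] --> 2 * pi * (j%:R * y).
  by apply: cvgM; [exact: cvg_cst|apply: cvgM; [exact: cvg_cst|exact: cvg_id]].
have sum_cont (f : R -> R) : continuous f ->
    continuous (fun y => \sum_(j < q) f (2 * pi * (j%:R * y))).
  move=> fc; apply: continuous_big => [|j _ y]; first exact: add_continuous.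
  exact: (cvg_continuous fc (lin j y)).
move=> y; apply: cvgM; first exact: cvg_cst.
apply: cvgD; apply: cvg_sqr.
  exact: (sum_cont _ (@continuous_cos R) y).
exact: (sum_cont _ (@continuous_sin R) y).
Qed.

End mask_theory.
End cis.

(** * The Fourier transform of a self-similar measure *)

Section fourier.
Variables (R : realType) (mu : probability (measurableTypeR R) R).
Local Notation T := (measurableTypeR R).

Definition bounded_mfun (h : R -> R) : Prop :=
  measurable_fun setT (h : T -> R) /\ exists M : R, forall x, `|h x| <= M.

Lemma bounded_mfun_integrable (h : R -> R) : bounded_mfun h ->
  mu.-integrable setT (EFin \o (h : T -> R)).
Proof.
move=> [mh [M hM]]; apply: measurable_bounded_integrable => //.
  by rewrite (le_lt_trans (probability_le1 _ _))// ltry.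
exists M; split; first exact: num_real.
by move=> y My x _ /=; rewrite (le_trans (hM x))// ltW.
Qed.

Lemma bounded_mfunD f g : bounded_mfun f -> bounded_mfun g ->
  bounded_mfun (fun x => f x + g x).
Proof.
move=> [mf [M fM]] [mg [N gN]]; split; first exact: measurable_funD.
by exists (M + N) => x; rewrite (le_trans (ler_normD _ _))// lerD.
Qed.

Lemma bounded_mfunM f g : bounded_mfun f -> bounded_mfun g ->
  bounded_mfun (fun x => f x * g x).
Proof.
move=> [mf [M fM]] [mg [N gN]]; split; first exact: measurable_funM.
by exists (M * N) => x; rewrite normrM ler_pM.
Qed.

Lemma bounded_mfun_cst a : bounded_mfun (fun=> a).
Proof. by split; [exact: measurable_cst|exists `|a|]. Qed.

Lemma bounded_mfunB f g : bounded_mfun f -> bounded_mfun g ->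
  bounded_mfun (fun x => f x - g x).
Proof.
move=> bf bg; have -> : (fun x => f x - g x) = (fun x => f x + (-1) * g x).
  by apply/funext => x; rewrite mulN1r.
by apply: bounded_mfunD => //; apply: bounded_mfunM => //; exact: bounded_mfun_cst.
Qed.

Lemma measurable_linear (a : R) : measurable_fun setT ((fun x => a * x) : T -> T).
Proof. exact: measurable_funM. Qed.

Lemma bounded_mfun_cos (a : R) : bounded_mfun (fun x => cos (a * x)).
Proof.
split; last by exists 1 => x; exact: cos_max.
apply: measurableT_comp; last exact: measurable_linear.
by apply: continuous_measurable_fun; exact: continuous_cos.
Qed.

Lemma bounded_mfun_sin (a : R) : bounded_mfun (fun x => sin (a * x)).
Proof.
split; last by exists 1 => x; exact: sin_max.
apply: measurableT_comp; last exact: measurable_linear.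
by apply: continuous_measurable_fun; exact: continuous_sin.
Qed.

Definition cbounded (f : R -> R[i]) : Prop :=
  bounded_mfun (fun x => complex.Re (f x)) /\ bounded_mfun (fun x => complex.Im (f x)).

Local Notation I f := (cintegral mu (f : T -> R[i])).

Lemma cboundedD f g : cbounded f -> cbounded g -> cbounded (fun x => f x + g x).
Proof.
move=> [f1 f2] [g1 g2]; split.
  by under eq_fun do rewrite cReD; exact: bounded_mfunD.
by under eq_fun do rewrite cImD; exact: bounded_mfunD.
Qed.

Lemma cboundedM f g : cbounded f -> cbounded g -> cbounded (fun x => f x * g x).
Proof.
move=> [f1 f2] [g1 g2]; split.
  under eq_fun do rewrite cReM.
  by apply: bounded_mfunB; exact: bounded_mfunM.
under eq_fun do rewrite cImM.
by apply: bounded_mfunD; exact: bounded_mfunM.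
Qed.

Lemma cbounded_cst a : cbounded (fun=> a).
Proof. by split; exact: bounded_mfun_cst. Qed.

Lemma cbounded_expi a : cbounded (expi a).
Proof. by split; [exact: bounded_mfun_cos|exact: bounded_mfun_sin]. Qed.

Lemma cbounded_sum (J : Type) (s : seq J) (f : J -> R -> R[i]) :
  (forall j, cbounded (f j)) -> cbounded (fun x => \sum_(j <- s) f j x).
Proof.
move=> bf; elim: s => [|j s IH].
  by under eq_fun do rewrite big_nil; exact: cbounded_cst.
by under eq_fun do rewrite big_cons; exact: cboundedD.
Qed.

Lemma cintegralD f g : cbounded f -> cbounded g ->
  I (fun x => f x + g x) = I f + I g.
Proof.
move=> [f1 f2] [g1 g2]; rewrite /cintegral.
under eq_Rintegral do rewrite cReD.
under [in X in Complex _ X]eq_Rintegral do rewrite cImD.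
by rewrite !RintegralD//; exact: bounded_mfun_integrable.
Qed.

Lemma cintegralZ a f : cbounded f -> I (fun x => a * f x) = a * I f.
Proof.
move=> [f1 f2]; rewrite /cintegral.
under eq_Rintegral do rewrite cReM.
under [in X in Complex _ X]eq_Rintegral do rewrite cImM.
have ok (u : R) h : bounded_mfun h -> bounded_mfun (fun x => u * h x).
  by apply: bounded_mfunM; exact: bounded_mfun_cst.
rewrite RintegralB// ?RintegralD//; try by apply/bounded_mfun_integrable/ok.
rewrite !RintegralZl//; try by apply/bounded_mfun_integrable.
by case: a.
Qed.

Lemma cintegral_sum (J : Type) (s : seq J) (f : J -> R -> R[i]) :
  (forall j, cbounded (f j)) ->
  I (fun x => \sum_(j <- s) f j x) = \sum_(j <- s) I (f j).
Proof.
move=> bf; elim: s => [|j s IH].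
  rewrite big_nil /cintegral.
  by under eq_Rintegral do rewrite big_nil; under [in X in Complex _ X]eq_Rintegral do rewrite big_nil;
     rewrite !Rintegral_cst// !mul0r.
rewrite big_cons -IH -cintegralD//; last exact: cbounded_sum.
by congr cintegral; apply/funext => x; rewrite big_cons.
Qed.

Definition fourier (u : R) : R[i] := I (expi u).

Lemma fourier0 : fourier 0 = 1.
Proof.
rewrite /fourier /cintegral.
have -> : (fun x : T => complex.Re (expi 0 x)) = cst 1.
  by apply/funext => x; rewrite /expi/= mulr0 mul0r cos0.
have -> : (fun x : T => complex.Im (expi 0 x)) = cst 0.
  by apply/funext => x; rewrite /expi/= mulr0 mul0r sin0.
by rewrite !Rintegral_cst//= probability_setT/= mul0r mul1r.
Qed.

Lemma fourier_continuous : continuous (fun u => sqn (fourier u)).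
Proof.
have trig_cont (f : R -> R) : continuous f -> (forall x, `|f x| <= 1) ->
    (forall a, bounded_mfun (fun x => f (a * x))) ->
    continuous (fun u => \int[mu]_(x in setT) f (2 * pi * u * x)).
  move=> fc f1 fb u.
  apply: (@continuity_under_integral _ _ _ mu (fun u x => f (2 * pi * u * x)) setT measurableT
    (u - 1) (u + 1) _ _ (cst 1)).
  - by move=> v _; apply: bounded_mfun_integrable; exact: fb.
  - apply: aeW => x _ v _ w.
    apply: cvg_continuous => //.
    by apply: cvgM; [apply: cvgM; [exact: cvg_cst|exact: cvg_id]|exact: cvg_cst].
  - by apply: bounded_mfun_integrable; exact: bounded_mfun_cst.
  - by move=> v _; apply: aeW => x _; exact: f1.
  - by rewrite inE/= in_itv/=; apply/andP; split; lra.
move=> u; apply: cvgD; apply: cvg_sqr.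
  by apply: trig_cont; [exact: continuous_cos|exact: cos_max|exact: bounded_mfun_cos].
by apply: trig_cont; [exact: continuous_sin|exact: sin_max|exact: bounded_mfun_sin].
Qed.

Section self_similarity.
Variables (q b : nat).
Hypotheses (q_gt1 : (1 < q)%N) (mu_cantor : is_cantor_measure q b mu).

Let f (i : nat) (x : T) : T := b%:R^-1 * (x + i%:R).

Let mf i : measurable_fun setT (f i).
Proof. by apply: measurable_funM => //; exact: measurable_funD. Qed.

(** The hypothesis says that mu is the sum of its images under the contractions,
    with weights 1/q. *)
Lemma ge0_integral_self_similar (h : T -> R) : measurable_fun setT h -> (forall x, 0 <= h x) ->
  (\int[mu]_x (h x)%:E = \sum_(i < q) (q%:R^-1)%:E * \int[mu]_x (h (f i x))%:E)%E.
Proof.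
move=> mh h0; have mh' : measurable_fun setT (EFin \o h) by exact/measurable_EFinP.
have q_inv_ge0 : 0 <= q%:R^-1 :> R by rewrite invr_ge0.
pose q_inv := NngNum q_inv_ge0.
pose nu' (i : nat) : {measure set T -> \bar R} :=
  mscale q_inv (pushforward mu (f i)).
pose nu := nu' mf.
rewrite (@eq_measure_integral _ _ _ setT (msum nu q)) => [|A mA _].
  rewrite (ge0_integral_measure_sum nu measurableT)//.
    apply: eq_bigr => i _; rewrite ge0_integral_mscale//.
      rewrite (ge0_integral_pushforward (mf i))// => x _; exact: h0.
    by move=> x _; exact: h0.
  by move=> x _; rewrite lee_fin.
exact: (mu_cantor mA).
Qed.

Let q0 : q%:R != 0 :> R.
Proof. by rewrite pnatr_eq0 -lt0n ltnW. Qed.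

Lemma bounded_mfun_comp (h : R -> R) i : bounded_mfun h -> bounded_mfun (h \o f i).
Proof.
move=> [mh [M hM]]; split; last by exists M => x /=.
by apply: measurableT_comp => //; exact: mf.
Qed.

(** Reduction to the nonnegative case by adding a bound of |h|. *)
Lemma Rintegral_self_similar (h : R -> R) : bounded_mfun h ->
  \int[mu]_x h x = \sum_(i < q) q%:R^-1 * \int[mu]_x h (f i x).
Proof.
move=> bh; have [mh [M hM]] := bh.
have bM : bounded_mfun (fun=> M) by exact: bounded_mfun_cst.
have hM0 x : 0 <= h x + M.
  by have := hM x; rewrite ler_norml => /andP[+ _]; rewrite -lerBlDr sub0r.
have cstM : \int[mu]_x (cst M x) = M.
  by rewrite Rintegral_cst//= probability_setT/= mulr1.
have intM g : bounded_mfun g -> \int[mu]_x (g x + M) = \int[mu]_x g x + M.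
  by move=> bg; rewrite RintegralD ?cstM//; exact: bounded_mfun_integrable.
apply: (addIr M); rewrite -intM//.
have -> : \int[mu]_x (h x + M) = \sum_(i < q) q%:R^-1 * \int[mu]_x (h (f i x) + M).
  have := @ge0_integral_self_similar (fun x => h x + M) (bounded_mfunD bh bM).1 hM0.
  rewrite /Rintegral => ->; rewrite -sum_fine => [|i _]; last first.
    rewrite fin_numM//; apply: (@integrable_fin_num _ _ _ mu setT) => //.
    by apply: (@bounded_mfun_integrable (fun x => h (f i x) + M));
      apply: bounded_mfunD => //; exact: (@bounded_mfun_comp h i).
  apply: eq_bigr => i _; rewrite fineM//.
  apply: (@integrable_fin_num _ _ _ mu setT) => //.
  by apply: (@bounded_mfun_integrable (fun x => h (f i x) + M));
    apply: bounded_mfunD => //; exact: (@bounded_mfun_comp h i).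
rewrite (eq_bigr (fun i : 'I_q => q%:R^-1 * \int[mu]_x h (f i x) + q%:R^-1 * M)) => [|i _].
  rewrite big_split/= sumr_const card_ord; congr +%R.
  by rewrite -[LHS]mulr_natl mulrA mulfV// mul1r.
by rewrite intM ?mulrDr//; exact: (@bounded_mfun_comp h i).
Qed.

Lemma cintegral_self_similar (g : R -> R[i]) : cbounded g ->
  I g = \sum_(i < q) (q%:R^-1)%:C%C * I (fun x => g (f i x)).
Proof.
move=> [g1 g2]; apply/eqP; rewrite eq_complex cRe_sum cIm_sum; apply/andP; split; apply/eqP.
  rewrite /cintegral/= (Rintegral_self_similar g1); apply: eq_bigr => i _.
  by rewrite /= mul0r subr0.
rewrite /cintegral/= (Rintegral_self_similar g2); apply: eq_bigr => i _.
by rewrite /= mul0r addr0.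
Qed.

Lemma fourier_self_similar u : fourier u = mask_poly q (u / b%:R) * fourier (u / b%:R).
Proof.
rewrite /fourier (cintegral_self_similar (cbounded_expi u)) /mask_poly -mulrA -big_distrr/=.
congr (_ * _); rewrite big_distrl/=; apply: eq_bigr => i _.
rewrite -cintegralZ; last exact: cbounded_expi.
congr cintegral; apply/funext => x; rewrite !expi_cis -cisD; congr cis.
by rewrite /f; ring.
Qed.

End self_similarity.
Lemma sqn_cst a : sqn (a%:C%C) = a ^+ 2 :> R.
Proof. by rewrite /sqn/= expr0n/= addr0. Qed.

End fourier.

(** * Square norms *)

Section square_norm.
Variables (R : realType) (mu : probability (measurableTypeR R) R).
Local Notation T := (measurableTypeR R).
Implicit Types (f g : R -> R[i]) (h : R -> R).

Definition cmeasurable f : Prop :=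
  measurable_fun setT ((fun x => complex.Re (f x)) : T -> R) /\
  measurable_fun setT ((fun x => complex.Im (f x)) : T -> R).

(** The square of the L^2 norm.  Approximation is expressed with it throughout,
    so that |z + w|^2 <= 2 |z|^2 + 2 |w|^2 takes the role of Minkowski's
    inequality. *)
Definition nsq f : \bar R := (\int[mu]_x (sqn (f x))%:E)%E.

Lemma normc_sqn (z : R[i]) : Normc.normc z ^+ 2 = sqn z.
Proof. by case: z => a b; rewrite /sqn/= sqr_sqrtr// addr_ge0 ?sqr_ge0. Qed.

Lemma normc_ge0 (z : R[i]) : 0 <= Normc.normc z.
Proof. by case: z => a b; rewrite /= sqrtr_ge0. Qed.

Lemma nsq_ge0 f : (0 <= nsq f)%E.
Proof. by apply: integral_ge0 => x _; rewrite lee_fin sqn_ge0. Qed.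

Lemma L2norm_sqr f : (L2norm mu (f : T -> R[i]) `^ 2 = nsq f)%E.
Proof.
rewrite /L2norm poweR_Lnorm ?pnatr_eq0//; apply: eq_integral => x _.
by rewrite /= ger0_norm ?normc_ge0// powR_mulrn ?normc_ge0// normc_sqn.
Qed.

Lemma L2norm_ge0 f : (0 <= L2norm mu (f : T -> R[i]))%E.
Proof. exact: Lnorm_ge0. Qed.

Lemma L2norm_lty f : (L2norm mu (f : T -> R[i]) < +oo)%E = (nsq f < +oo)%E.
Proof.
rewrite -L2norm_sqr; move: (L2norm_ge0 f); case: (L2norm _ _) => [x||]//= _.
- by rewrite !ltry.
- by rewrite pnatr_eq0.
Qed.

Lemma L2norm_lt f (e : R) : 0 < e ->
  (L2norm mu (f : T -> R[i]) < e%:E)%E = (nsq f < (e ^+ 2)%:E)%E.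
Proof.
move=> e0; rewrite -L2norm_sqr; move: (L2norm_ge0 f); case: (L2norm _ _) => [x||]//=.
- rewrite lee_fin => x0.
  rewrite powR_mulrn// !lte_fin.
  by rewrite ltr_pXn2r// nnegrE ltW.
- by move=> _; rewrite pnatr_eq0/= !ltNge !leey.
Qed.

Lemma cmeasurableD f g : cmeasurable f -> cmeasurable g ->
  cmeasurable (fun x => f x + g x).
Proof.
move=> [f1 f2] [g1 g2]; split.
  by under eq_fun do rewrite cReD; exact: measurable_funD.
by under eq_fun do rewrite cImD; exact: measurable_funD.
Qed.

Lemma cmeasurableM f g : cmeasurable f -> cmeasurable g ->
  cmeasurable (fun x => f x * g x).
Proof.
move=> [f1 f2] [g1 g2]; split.
  under eq_fun do rewrite cReM.
  by apply: measurable_funB; exact: measurable_funM.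
under eq_fun do rewrite cImM.
by apply: measurable_funD; exact: measurable_funM.
Qed.

Lemma cbounded_cmeasurable f : cbounded f -> cmeasurable f.
Proof. by move=> [[? _] [? _]]. Qed.

Lemma cmeasurable_cst a : cmeasurable (fun=> a).
Proof. exact/cbounded_cmeasurable/cbounded_cst. Qed.

Lemma cmeasurable_expi a : cmeasurable (expi a).
Proof. exact/cbounded_cmeasurable/cbounded_expi. Qed.

Lemma cmeasurableZ a f : cmeasurable f -> cmeasurable (fun x => a * f x).
Proof. by apply: cmeasurableM; exact: cmeasurable_cst. Qed.

Lemma cmeasurableB f g : cmeasurable f -> cmeasurable g ->
  cmeasurable (fun x => f x - g x).
Proof.
move=> mf mg; have -> : (fun x => f x - g x) = (fun x => f x + (-1) * g x).
  by apply/funext => x; rewrite mulN1r.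
by apply: cmeasurableD => //; exact: cmeasurableZ.
Qed.

Lemma cmeasurable_real h : measurable_fun setT (h : T -> R) ->
  cmeasurable (fun x => (h x)%:C%C).
Proof. by move=> mh; split => //=; exact: measurable_cst. Qed.

Lemma measurable_sqn f : cmeasurable f ->
  measurable_fun setT ((fun x => (sqn (f x))%:E) : T -> \bar R).
Proof.
move=> [f1 f2]; apply/measurable_EFinP; rewrite /sqn.
by apply: measurable_funD; exact: measurable_funX.
Qed.

Lemma le_nsq f g : cmeasurable f -> cmeasurable g ->
  (forall x, sqn (f x) <= sqn (g x)) -> (nsq f <= nsq g)%E.
Proof.
move=> mf mg fg; apply: ge0_le_integral => //.
- by move=> x _; rewrite lee_fin sqn_ge0.
- exact: measurable_sqn.
- exact: measurable_sqn.
- by move=> x _; rewrite lee_fin.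
Qed.

Lemma nsqZ a f : cmeasurable f -> nsq (fun x => a * f x) = ((sqn a)%:E * nsq f)%E.
Proof.
move=> mf; rewrite /nsq; under eq_integral do rewrite sqnM EFinM.
rewrite ge0_integralZl//; first exact: measurable_sqn.
- by move=> x _; rewrite lee_fin sqn_ge0.
- by rewrite lee_fin sqn_ge0.
Qed.

Lemma sqnD (z w : R[i]) : sqn (z + w) <= 2 * sqn z + 2 * sqn w.
Proof.
case: z => a b; case: w => c d; rewrite /sqn/=.
by have := sqr_ge0 (a - c); have := sqr_ge0 (b - d); nra.
Qed.

Lemma nsqD f g : cmeasurable f -> cmeasurable g ->
  (nsq (fun x => f x + g x)%R <= 2%:E * nsq f + 2%:E * nsq g)%E.
Proof.
move=> mf mg.
have m2 k : cmeasurable k -> measurable_fun setT ((fun x => (2%:E * (sqn (k x))%:E)%E) : T -> \bar R).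
  by move=> mk; apply: emeasurable_funM => //; exact: measurable_sqn.
rewrite /nsq -!ge0_integralZl//; try (exact: measurable_sqn); try by move=> x _; rewrite lee_fin sqn_ge0.
rewrite -ge0_integralD//; try (exact: m2); try by move=> x _; rewrite mule_ge0// lee_fin sqn_ge0.
apply: ge0_le_integral => //.
- by move=> x _; rewrite lee_fin sqn_ge0.
- by apply: measurable_sqn; exact: cmeasurableD.
- by apply: emeasurable_funD; exact: m2.
- by move=> x _; rewrite -!EFinM -EFinD lee_fin sqnD.
Qed.

Lemma nsqD_lt f g (e : R) : cmeasurable f -> cmeasurable g ->
  (nsq f < (e / 4)%:E)%E -> (nsq g < (e / 4)%:E)%E ->
  (nsq (fun x => f x + g x)%R < e%:E)%E.
Proof.
move=> mf mg fe ge; apply: le_lt_trans (nsqD mf mg) _.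
have -> : e = 2 * (e / 4) + 2 * (e / 4) by field.
by rewrite [X in (_ < X)%E]EFinD EFinM; apply: lteD; rewrite lte_pmul2l.
Qed.

(** Dominated convergence for |u n|^2 |f|^2, with the bound M^2 |f|^2. *)
Lemma nsq_dominated f (u : nat -> R -> R) (M : R) :
  cmeasurable f -> (nsq f < +oo)%E ->
  (forall n, measurable_fun setT (u n : T -> R)) ->
  (forall n x, `|u n x| <= M) -> (forall x, u n x @[n --> \oo] --> (0 : R)) ->
  forall e : R, 0 < e -> exists n, (nsq (fun x => (u n x)%:C%C * f x)%R < e%:E)%E.
Proof.
move=> mf finf mu_ uM u0 e e0.
have mg n : measurable_fun setT ((fun x => (sqn ((u n x)%:C%C * f x)%R)%:E) : T -> \bar R).
  by apply: measurable_sqn; apply: cmeasurableM => //; exact: cmeasurable_real.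
have sqnE' n x : sqn ((u n x)%:C%C * f x) = u n x ^+ 2 * sqn (f x).
  by rewrite sqnM sqn_cst.
have mc : measurable_fun setT (cst 0%E : T -> \bar R) by exact: measurable_cst.
have [|||_ _] := @dominated_convergence _ T R mu setT measurableT
  (fun n x => (sqn ((u n x)%:C%C * f x)%R)%:E) (cst 0%E)
  (fun x => ((M ^+ 2)%:E * (sqn (f x))%:E)%E) mg mc.
- apply: aeW => x _.
  have lim0 : (u n x ^+ 2 * sqn (f x)) @[n --> \oo] --> (0 : R).
    have -> : (0 : R) = 0 * 0 * sqn (f x) by rewrite !mul0r.
    by apply: cvgM; [exact: (cvgM (u0 x) (u0 x))|exact: cvg_cst].
  under eq_fun do rewrite sqnE'.
  by apply/cvg_EFin; [exact: nearW|exact: lim0].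
- apply: integrableZl => //; apply/integrableP; split; first exact: measurable_sqn.
  by under eq_integral do rewrite gee0_abs ?lee_fin ?sqn_ge0//.
- apply: aeW => x n _ /=; rewrite sqnE' ger0_norm; last by rewrite mulr_ge0 ?sqr_ge0 ?sqn_ge0.
  rewrite -EFinM lee_fin ler_wpM2r ?sqn_ge0// -real_normK ?num_real//.
  by rewrite lerXn2r ?nnegrE// (le_trans _ (uM n x)).
rewrite integral0 => /fine_cvgP[fin_near /cvgrPdist_lt/(_ e e0) small].
have [n [fn sn]] := filter_ex (filterI fin_near small).
exists n; move: fn sn => /=; rewrite -/(nsq _) => fn sn.
rewrite -(fineK fn) lte_fin.
by move: sn; rewrite sub0r normrN; apply: le_lt_trans; exact: ler_norm.
Qed.

(** * Closed spans of exponentials *)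

(** Lists of pairs (frequency, coefficient), possibly with repeated frequencies,
    so that sums are concatenations; [trig_coef] collects equal frequencies. *)
Definition trig (s : seq (R * R[i])) : R -> R[i] :=
  fun x => \sum_(p <- s) p.2 * expi p.1 x.

Lemma cbounded_trig s : cbounded (trig s).
Proof.
by apply: cbounded_sum => p; apply: cboundedM; [exact: cbounded_cst|exact: cbounded_expi].
Qed.

Lemma cmeasurable_trig s : cmeasurable (trig s).
Proof. exact/cbounded_cmeasurable/cbounded_trig. Qed.

Section closed_span.
Variable Lam : set R.

(** Membership in the closed span of the exponentials with frequency in Lam. *)
Definition approximable f : Prop := forall e : R, 0 < e ->
  exists s : seq (R * R[i]),
    (forall p, p \in s -> Lam p.1) /\ (nsq (fun x => f x - trig s x)%R < e%:E)%E.

Lemma approximable_closed f : cmeasurable f ->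
  (forall e : R, 0 < e -> exists g, [/\ cmeasurable g, approximable g &
     (nsq (fun x => f x - g x)%R < e%:E)%E]) -> approximable f.
Proof.
move=> mf fg e e0; have e4 : 0 < e / 4 by rewrite divr_gt0.
have [g [mg ag fge]] := fg _ e4.
have [s [sL gs]] := ag _ e4; exists s; split => //.
have -> : (fun x => f x - trig s x) = (fun x => (f x - g x) + (g x - trig s x)).
  by apply/funext => x; rewrite addrA subrK.
by apply: nsqD_lt => //; apply: cmeasurableB => //; exact: cmeasurable_trig.
Qed.

Lemma approximableD f g : cmeasurable f -> cmeasurable g ->
  approximable f -> approximable g -> approximable (fun x => f x + g x).
Proof.
move=> mf mg af ag e e0; have e4 : 0 < e / 4 by rewrite divr_gt0.
have [s [sL fs]] := af _ e4; have [t [tL gt]] := ag _ e4.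
exists (s ++ t); split.
  by move=> p; rewrite mem_cat => /orP[/sL|/tL].
have -> : (fun x => f x + g x - trig (s ++ t) x) =
    (fun x => (f x - trig s x) + (g x - trig t x)).
  by apply/funext => x; rewrite /trig big_cat/= opprD addrACA.
by apply: nsqD_lt => //; apply: cmeasurableB => //; exact: cmeasurable_trig.
Qed.

Lemma approximableZ a f : cmeasurable f ->
  approximable f -> approximable (fun x => a * f x).
Proof.
move=> mf af e e0.
have a1 : 0 < sqn a + 1 by rewrite ltr_pwDr ?sqn_ge0.
have e1 : 0 < e / (sqn a + 1) by rewrite divr_gt0.
have [s [sL fs]] := af _ e1.
exists [seq (p.1, a * p.2) | p <- s]; split.
  by move=> p /mapP[p' /sL ? ->].
have -> : (fun x => a * f x - trig [seq (p.1, a * p.2) | p <- s] x) =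
    (fun x => a * (f x - trig s x)).
  apply/funext => x; rewrite /trig big_map mulrBr big_distrr/=.
  by congr (_ - _); apply: eq_bigr => p _; rewrite mulrA.
rewrite nsqZ; last by apply: cmeasurableB => //; exact: cmeasurable_trig.
apply: le_lt_trans (_ : _ <= (sqn a)%:E * (e / (sqn a + 1))%:E)%E _.
  by apply: lee_pmul; rewrite ?lee_fin ?sqn_ge0 ?nsq_ge0// ltW.
rewrite -EFinM lte_fin mulrA ltr_pdivrMr// mulrC ltr_pM2l//.
by rewrite ltrDl.
Qed.

Lemma approximable0 : approximable (fun=> 0).
Proof.
move=> e e0; exists [::]; split => //.
rewrite /nsq (_ : (fun x => _) = cst 0%E) ?integral0//.
by apply/funext => x; rewrite /trig big_nil subr0 /sqn/= expr0n/= addr0.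
Qed.

Lemma approximable_sum (J : Type) (s : seq J) (f : J -> R -> R[i]) :
  (forall j, cmeasurable (f j)) -> (forall j, approximable (f j)) ->
  approximable (fun x => \sum_(j <- s) f j x).
Proof.
move=> mf af; elim: s => [|j s IH].
  by under eq_fun do rewrite big_nil; exact: approximable0.
under eq_fun do rewrite big_cons; apply: approximableD => //.
elim: s {IH} => [|k s IH].
  by under eq_fun do rewrite big_nil; exact: cmeasurable_cst.
by under eq_fun do rewrite big_cons; exact: cmeasurableD.
Qed.

Hypothesis approximable_expi : forall u, approximable (expi u).

(** Multiplication by [expi u] is an isometry which maps exponentials to
    exponentials, and these are approximable whatever their frequency. *)
Lemma approximable_modulation u f : cmeasurable f -> approximable f ->
  approximable (fun x => expi u x * f x).
Proof.
move=> mf af.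
have me := cmeasurable_expi u.
apply: approximable_closed; first exact: cmeasurableM.
move=> e e0; have [s [_ fs]] := af e e0.
exists (fun x => \sum_(p <- s) p.2 * expi (u + p.1) x); split.
- apply/cbounded_cmeasurable/cbounded_sum => p.
  by apply: cboundedM; [exact: cbounded_cst|exact: cbounded_expi].
- apply: approximable_sum => p; first exact/cmeasurableZ/cmeasurable_expi.
  by apply: approximableZ => //; exact: cmeasurable_expi.
have -> : (fun x => expi u x * f x - \sum_(p <- s) p.2 * expi (u + p.1) x) =
    (fun x => expi u x * (f x - trig s x)).
  apply/funext => x; rewrite mulrBr; congr (_ - _); rewrite big_distrr/=.
  by apply: eq_bigr => p _; rewrite !expi_cis mulrDl cisD; ring.
apply: le_lt_trans fs; apply: le_nsq.
- by apply: cmeasurableM => //; apply: cmeasurableB => //; exact: cmeasurable_trig.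
- by apply: cmeasurableB => //; exact: cmeasurable_trig.
- by move=> x; rewrite sqnM expi_cis sqn_cis mul1r.
Qed.

(** * Multipliers of the closed span *)

Definition multiplier h : Prop :=
  bounded_mfun h /\ forall f, cmeasurable f -> (nsq f < +oo)%E ->
    approximable f -> approximable (fun x => (h x)%:C%C * f x).

Lemma cmeasurable_mult h f : bounded_mfun h -> cmeasurable f ->
  cmeasurable (fun x => (h x)%:C%C * f x).
Proof. by move=> [mh _] mf; apply: cmeasurableM => //; exact: cmeasurable_real. Qed.

Lemma nsq_mult_fin h f : bounded_mfun h -> cmeasurable f -> (nsq f < +oo)%E ->
  (nsq (fun x => (h x)%:C%C * f x)%R < +oo)%E.
Proof.
move=> bh mf ff; have [_ [M hM]] := bh.
apply: (@le_lt_trans _ _ ((sqn M%:C%C)%:E * nsq f)%E).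
  rewrite -nsqZ//; apply: le_nsq; [exact: cmeasurable_mult|exact: cmeasurableZ|].
  move=> x; rewrite !sqnM ler_wpM2r ?sqn_ge0// !sqn_cst -real_normK ?num_real//.
  by rewrite lerXn2r ?nnegrE// (le_trans _ (hM x)).
by rewrite lte_mul_pinfty// lee_fin sqn_ge0.
Qed.

Lemma multiplier_cst a : multiplier (fun=> a).
Proof.
by split; [exact: bounded_mfun_cst|move=> f mf _; exact: approximableZ].
Qed.

Lemma multiplierD h k : multiplier h -> multiplier k ->
  multiplier (fun x => h x + k x).
Proof.
move=> [bh ah] [bk ak]; split; first exact: bounded_mfunD.
move=> f mf ff af; under eq_fun do rewrite rmorphD mulrDl.
by apply: approximableD; [exact: cmeasurable_mult|exact: cmeasurable_mult|exact: ah|exact: ak].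
Qed.

Lemma multiplierM h k : multiplier h -> multiplier k ->
  multiplier (fun x => h x * k x).
Proof.
move=> [bh ah] [bk ak]; split; first exact: bounded_mfunM.
move=> f mf ff af; under eq_fun do rewrite rmorphM/= -mulrA.
by apply: ah; [exact: cmeasurable_mult|exact: nsq_mult_fin|exact: ak].
Qed.

Lemma multiplier_sum (J : Type) (s : seq J) (h : J -> R -> R) :
  (forall j, multiplier (h j)) -> multiplier (fun x => \sum_(j <- s) h j x).
Proof.
move=> mh; elim: s => [|j s IH].
  by under eq_fun do rewrite big_nil; exact: multiplier_cst.
by under eq_fun do rewrite big_cons; exact: multiplierD.
Qed.

(** By dominated convergence, h f is the limit of the hn n f in L^2. *)
Lemma multiplier_lim (hn : nat -> R -> R) h (M : R) :
  (forall n, multiplier (hn n)) -> (forall n x, `|hn n x| <= M) ->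
  (forall x, hn n x @[n --> \oo] --> h x) -> multiplier h.
Proof.
move=> mhn hnM lim.
have mh : measurable_fun setT (h : T -> R).
  apply: (measurable_fun_cvg (h := hn : nat -> T -> R)) => // n.
  by case: (mhn n) => -[].
have hM x : `|h x| <= M.
  rewrite leNgt; apply/negP => Mh.
  have e0 : 0 < `|h x| - M by rewrite subr_gt0.
  have /cvgrPdist_lt/(_ _ e0)/filter_ex[n] := lim x.
  rewrite ltrBrDl ltNge => /negP; apply; rewrite -[leLHS]/(`|h x|).
  rewrite -[X in `|X| <= _](subrK (hn n x)) (le_trans (ler_normD _ _))//.
  by rewrite addrC lerD2r.
have bh : bounded_mfun h by split => //; exists M.
split => // f mf ff af; apply: approximable_closed; first exact: cmeasurable_mult.
move=> e e0.
have [n ne] : exists n, (nsq (fun x => (h x - hn n x)%:C%C * f x)%R < e%:E)%E.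
  apply: (@nsq_dominated f (fun n x => h x - hn n x) (M + M)) => //.
  - by move=> n; apply: measurable_funB => //; case: (mhn n) => -[].
  - by move=> n x; rewrite (le_trans (ler_normB _ _))// lerD.
  - by move=> x; rewrite -(subrr (h x)); apply: cvgB => //; exact: cvg_cst.
have [bn an] := mhn n.
exists (fun x => (hn n x)%:C%C * f x); split.
- exact: cmeasurable_mult.
- exact: an.
- by under [X in nsq X]eq_fun do rewrite -mulrBl -rmorphB.
Qed.

Lemma multiplier_sin (nu a : R) : multiplier (fun x => sin (2 * pi * (nu * (x - a)))).
Proof.
split.
  split; last by exists 1 => x; exact: sin_max.
  apply: (measurableT_comp (f := sin)); last first.
    apply: measurable_funM => //; apply: measurable_funM => //.
    exact: measurable_funD.
  by apply: continuous_measurable_fun; exact: continuous_sin.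
move=> f mf ff af.
pose k : R[i] := Complex 0 (- 2^-1).
have E x : (sin (2 * pi * (nu * (x - a))))%:C%C * f x =
    (k * cis (- (nu * a))) * (expi nu x * f x) +
    (- k * cis (nu * a)) * (expi (- nu) x * f x).
  have K u : (sin (2 * pi * u))%:C%C = k * cis u + - k * cis (- u).
    by rewrite cisN mulNr -mulrBr /k /cis/conjc/=; congr Complex => /=; field.
  have c1 : cis (nu * (x - a)) = cis (- (nu * a)) * cis (nu * x).
    by rewrite -cisD; congr cis; ring.
  have c2 : cis (- (nu * (x - a))) = cis (nu * a) * cis (- nu * x).
    by rewrite -cisD; congr cis; ring.
  by rewrite K !expi_cis c1 c2; ring.
under eq_fun do rewrite E.
have me u := cmeasurableM (cmeasurable_expi u) mf.
by apply: approximableD; [exact/cmeasurableZ/me|exact/cmeasurableZ/me| |];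
  apply: approximableZ; [exact: me|exact: approximable_modulation|
                         exact: me|exact: approximable_modulation].
Qed.

(** The fixed points of this odd polynomial in [-1, 1] are -1, 0 and 1, and its
    iterates push all other points away from 0: they converge to the sign. *)
Definition sharpen (y : R) : R := y * (3 - y ^+ 2) / 2.

Lemma iter_sharpenN n y : iter n sharpen (- y) = - iter n sharpen y.
Proof. by elim: n => //= n ->; rewrite /sharpen sqrrN !mulNr. Qed.

(** With z the current iterate, 1 - sharpen z = (1 - z) ((1 - z)(2 + z)/2), and
    the second factor is at most 1 - z/2 <= 1 - y/2 since y <= z. *)
Lemma iter_sharpen_gt0 n y : 0 < y <= 1 ->
  [/\ y <= iter n sharpen y, iter n sharpen y <= 1 &
   1 - iter n sharpen y <= (1 - y / 2) ^+ n].
Proof.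
move=> /andP[y0 y1]; elim: n => [|n [ge_y le_1 le_pow]].
  by split; rewrite //= expr0; lra.
rewrite iterS; set z := iter n _ _ in ge_y le_1 le_pow *.
have z0 : 0 < z by exact: lt_le_trans ge_y.
have E : 1 - sharpen z = (1 - z) * ((1 - z) * (2 + z) / 2) by rewrite /sharpen; field.
have zfac : 0 <= (1 - z) * (2 + z) / 2 <= 1 - y / 2.
  by apply/andP; split; [rewrite divr_ge0// mulr_ge0//; lra|nra].
have /andP[zf0 zf1] := zfac.
split.
- have : 0 <= z * (1 - z ^+ 2) by rewrite mulr_ge0 ?subr_ge0 ?exprn_ile1// ltW.
  by rewrite /sharpen; lra.
- by rewrite -subr_ge0 E mulr_ge0// subr_ge0.
- by rewrite E exprSr; apply: ler_pM => //; rewrite subr_ge0.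
Qed.

Lemma norm_iter_sharpen n y : `|y| <= 1 -> `|iter n sharpen y| <= 1.
Proof.
have pos z : 0 < z <= 1 -> `|iter n sharpen z| <= 1.
  move=> z1; have [zi iz _] := iter_sharpen_gt0 n z1.
  by rewrite ger0_norm// (le_trans _ zi)//; case/andP: z1 => /ltW.
have [y0|y0|->] := ltgtP y 0; rewrite ?normr0.
- rewrite ler0_norm ?(ltW y0)// => y1.
  by rewrite -[y]opprK iter_sharpenN normrN pos// oppr_gt0 y0.
- by rewrite ger0_norm ?(ltW y0)// => y1; rewrite pos// y0.
- move=> _; have -> : iter n sharpen 0 = 0.
    by elim: n {pos} => //= n ->; rewrite /sharpen mul0r mul0r.
  by rewrite normr0.
Qed.

Lemma iter_sharpen_cvg y : `|y| <= 1 ->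
  iter n sharpen y @[n --> \oo] --> Num.sg y.
Proof.
have pos z : 0 < z <= 1 -> iter n sharpen z @[n --> \oo] --> (1 : R).
  move=> z1; have /andP[z0 z1'] := z1.
  apply/cvgrPdist_lt => e e0.
  have zz : `|1 - z / 2| < 1 by rewrite ltr_norml; apply/andP; split; lra.
  have /cvgrPdist_lt/(_ e e0) := cvg_expr zz; apply: filterS => n.
  have [zi iz pow] := iter_sharpen_gt0 n z1.
  rewrite sub0r normrN => powe; rewrite ger0_norm ?subr_ge0//.
  by rewrite (le_lt_trans pow)// (le_lt_trans (ler_norm _)).
have [y0|y0|->] := ltgtP y 0.
- rewrite ler0_norm ?(ltW y0)// => y1; rewrite ltr0_sg//.
  have -> : (fun n => iter n sharpen y) = (fun n => - iter n sharpen (- y)).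
    by apply/funext => n; rewrite iter_sharpenN opprK.
  by apply: cvgN; apply: pos; rewrite oppr_gt0 y0.
- by rewrite ger0_norm ?(ltW y0)// => y1; rewrite gtr0_sg//; apply: pos; rewrite y0.
- move=> _; rewrite sgr0; have -> : (fun n => iter n sharpen 0) = cst 0.
    by apply/funext; elim => //= n ->; rewrite /sharpen mul0r mul0r.
  exact: cvg_cst.
Qed.

Lemma multiplier_sg h : (forall x, `|h x| <= 1) -> multiplier h ->
  multiplier (fun x => Num.sg (h x)).
Proof.
move=> h1 mh; apply: (@multiplier_lim (fun n x => iter n sharpen (h x)) _ 1).
- elim=> [//|n IH]; rewrite /= /sharpen.
  apply: multiplierM (multiplier_cst _); apply: (multiplierM IH).
  have -> : (fun x => 3 - iter n sharpen (h x) ^+ 2) =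
            (fun x => 3 + (-1) * (iter n sharpen (h x) * iter n sharpen (h x))).
    by apply/funext => x; rewrite mulN1r expr2.
  apply: multiplierD (multiplier_cst _) _; apply: multiplierM (multiplier_cst _) _.
  exact: (multiplierM IH IH).
- by move=> n x; exact: norm_iter_sharpen.
- by move=> x; exact: iter_sharpen_cvg.
Qed.

Lemma sg_sin (u : R) : `|u| < 2^-1 -> Num.sg (sin (2 * pi * u)) = Num.sg u.
Proof.
have pos v : 0 < v < 2^-1 -> Num.sg (sin (2 * pi * v)) = 1.
  move=> /andP[v0 v1]; rewrite gtr0_sg// sin_gt0_pi// !mulr_gt0 ?pi_gt0//=.
  by rewrite mulrAC gtr_pMl ?pi_gt0//; lra.
have [u0|u0|->] := ltgtP u 0; last by rewrite mulr0 sin0.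
- rewrite ltr0_norm// => u1.
  by rewrite -[in LHS](opprK u) mulrN sinN sgrN pos ?oppr_gt0 ?u0// ltr0_sg.
- by rewrite gtr0_norm// => u1; rewrite pos ?u0// gtr0_sg.
Qed.

(** On a bounded set and for n large, the sine of 2 pi (x - a)/(n + 1) has the
    sign of x - a. *)
Lemma multiplier_ray (a : R) : multiplier (fun x => Num.sg (x - a)).
Proof.
apply: (@multiplier_lim (fun n x => Num.sg (sin (2 * pi * (n.+1%:R^-1 * (x - a))))) _ 1).
- by move=> n; apply: multiplier_sg; [move=> x; exact: sin_max|exact: multiplier_sin].
- by move=> n x; rewrite normr_sg; case: (_ != 0).
move=> x; apply: cvg_near_cst.
exists (Num.bound (2 * `|x - a|)) => // n /= nx.
have n0 : 0 < n.+1%:R :> R by rewrite ltr0n.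
rewrite sg_sin.
  by rewrite sgrM gtr0_sg ?invr_gt0// mul1r.
rewrite normrM normfV (ger0_norm (ltW n0)) mulrC ltr_pdivrMr//.
have := archi_boundP (mulr_ge0 (ler0n R 2) (normr_ge0 (x - a))).
have : (Num.bound (2 * `|x - a|))%:R <= n.+1%:R :> R by rewrite ler_nat (leq_trans nx).
lra.
Qed.

(** The sets whose indicator is a multiplier form a sigma-algebra; open
    half-lines generate the Borel sets, and (s^2 + s)/2 is the indicator of
    ]a, +oo[ when s is the sign of x - a. *)
Lemma multiplier_indic (A : set T) : measurable A ->
  multiplier (fun x : R => \1_A x).
Proof.
rewrite RGenOInfty.measurableE.
apply: (@smallest_sub _ _ _ [set A | multiplier (fun x : R => \1_A x)]).
  split.
  - rewrite /= (_ : (fun x => _) = fun=> 0) ?indic0//; exact: multiplier_cst.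
  - move=> B /= mB; rewrite (_ : (fun x => _) = fun x => 1 + (-1) * \1_B x).
      by apply: multiplierD (multiplier_cst _) _; exact: multiplierM (multiplier_cst _) _.
    apply/funext => x; rewrite !indicE mulN1r setTD in_setC.
    by case: (x \in B); rewrite ?subrr ?subr0.
  - move=> B mB /=.
    apply: (@multiplier_lim (fun n x => 1 + (-1) * \prod_(i < n) (1 + (-1) * \1_(B i) x)) _ 2).
    + move=> n; apply: multiplierD (multiplier_cst _) _; apply: multiplierM (multiplier_cst _) _.
      elim: n => [|n IH]; first by under eq_fun do rewrite big_ord0; exact: multiplier_cst.
      under eq_fun do rewrite big_ord_recr/=; apply: multiplierM IH _.
      by apply: multiplierD (multiplier_cst _) _; exact: multiplierM (multiplier_cst _) (mB n).
    + move=> n x; rewrite (le_trans (ler_normD _ _))// normr1 -[2]/(1 + 1) lerD2l.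
      rewrite mulN1r normrN ger0_norm; first apply: prodr_ile1 => i _.
        by rewrite indicE; case: (_ \in _) => /=; apply/andP; split; lra.
      by apply: prodr_ge0 => i _; rewrite indicE; case: (_ \in _) => /=; lra.
    + move=> x; apply: cvg_near_cst.
      have [[i _ Bi]|nB] := pselect ((\bigcup_n B n) x).
        exists i.+1 => // n /= ni.
        rewrite (bigD1 (Ordinal ni))//= !indicE !mem_set//; last by exists i.
        by rewrite /= mulr1 subrr mul0r mulr0 addr0.
      near=> n; rewrite big1 => [|i _].
        by rewrite indicE memNset//= mulr1 subrr.
      by rewrite indicE memNset ?mulr0 ?addr0// => Bi; apply: nB; exists i.
move=> _ [a ->] /=.
rewrite (_ : (fun x => _) = fun x => (Num.sg (x - a) * Num.sg (x - a) + Num.sg (x - a)) * 2^-1).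
  apply: multiplierM (multiplier_cst _); apply: multiplierD; last exact: multiplier_ray.
  by apply: multiplierM; exact: multiplier_ray.
apply/funext => x; rewrite indicE mem_setE in_itv/= andbT.
have [xa|xa|->] := ltgtP x a.
- by rewrite ltr0_sg ?subr_lt0//=; ring.
- by rewrite gtr0_sg ?subr_gt0//=; field.
- by rewrite subrr sgr0/=; ring.
Unshelve. all: by end_near.
Qed.

(** The sum is the integer part of y. *)
Lemma floor_sum (y : R) (K : nat) : 0 <= y <= K%:R ->
  0 <= y - \sum_(k < K) (k.+1%:R <= y)%R%:R <= 1.
Proof.
move=> /andP[y0]; elim: K => [|K IH] yK.
  by rewrite big_ord0 subr0 y0 (le_trans yK).
rewrite big_ord_recr/=; have [yK'|Ky] := leP y K%:R.
  have -> : (K.+1%:R <= y) = false.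
    by apply/negbTE; rewrite -ltNge (le_lt_trans yK')// ltr_nat.
  by rewrite addr0 IH.
rewrite (eq_bigr (fun=> 1)) => [|k _]; last first.
  by rewrite (_ : _ <= _ = true)// (le_trans _ (ltW Ky))// ler_nat.
rewrite sumr_const card_ord -natr1 in yK *.
have [h|h] := leP (K%:R + 1) y; rewrite /= ?mulr1n ?mulr0n; apply/andP; split; lra.
Qed.

Lemma measurable_preimage_itv (u : T -> R) (i : interval R) :
  measurable_fun setT u -> measurable [set x | u x \in i].
Proof.
move=> mu_; rewrite -[X in measurable X]setTI.
exact: (mu_ measurableT _ (measurable_itv i)).
Qed.

(** Uniform approximation by step functions: h + m is rounded down to a multiple
    of 1/(N+1), and written as the sum of the indicators of its level sets. *)
Lemma multiplier_bounded h : bounded_mfun h -> multiplier h.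
Proof.
move=> [mh [M hM]]; pose m := Num.bound M.
have hm x : `|h x| <= m%:R.
  have M0 : 0 <= M by rewrite (le_trans _ (hM 0)).
  by rewrite (le_trans (hM x))// ltW// archi_boundP.
pose y N x := (h x + m%:R) * N.+1%:R.
pose hn N x : R := (\sum_(k < m.*2 * N.+1) (k.+1%:R <= y N x)%R%:R) * N.+1%:R^-1 + (- m%:R).
have N0 N : 0 < N.+1%:R :> R by rewrite ltr0n.
have close N x : 0 <= h x - hn N x <= N.+1%:R^-1.
  have /floor_sum/andP[s0 s1] : 0 <= y N x <= (m.*2 * N.+1)%:R.
    rewrite /y natrM -addnn natrD ler_pM2r// mulr_ge0 ?(ltW (N0 N))//=.
      by have := hm x; rewrite ler_norml lerD2r => /andP[].
    by have := hm x; rewrite ler_norml -lerBlDr sub0r => /andP[].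
  have -> : h x - hn N x = (y N x - \sum_(k < m.*2 * N.+1) (k.+1%:R <= y N x)%R%:R) * N.+1%:R^-1.
    by rewrite mulrBl /y mulfK ?lt0r_neq0// /hn; ring.
  by rewrite ler_piMl ?invr_ge0 ?(ltW (N0 N))// andbT mulr_ge0// invr_ge0 ltW.
apply: (@multiplier_lim hn _ (m%:R + 1)).
- move=> N; apply: multiplierD (multiplier_cst _); apply: multiplierM (multiplier_cst _).
  apply: multiplier_sum => k.
  have mA : measurable ([set x | k.+1%:R <= y N x] : set T).
    have my : measurable_fun setT (y N : T -> R).
      by apply: measurable_funM => //; exact: measurable_funD.
    have := measurable_preimage_itv `[k.+1%:R, +oo[ my.
    by under eq_set do rewrite in_itv andbT.
  have := multiplier_indic mA; congr multiplier; apply/funext => x.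
  by rewrite indicE /=; congr (nat_of_bool _)%:R; apply/asboolP/idP.
- move=> N x; have /andP[c0 c1] := close N x.
  have : N.+1%:R^-1 <= 1 :> R by rewrite invf_le1// ler1n.
  move: (hm x) (hn N x) c0 c1 => + z c0 c1; move: (m%:R : R) => mR; rewrite !ler_norml => /andP[h1 h2] N1.
  have {c1} c1 := le_trans c1 N1.
  by clear hm close; apply/andP; split; lra.
- move=> x; apply/cvgrPdist_lt => e e0.
  have /cvgrPdist_lt/(_ e e0) := @cvg_harmonic R; apply: filterS => N.
  rewrite sub0r normrN /harmonic => small; have /andP[c0 c1] := close N x.
  by rewrite ger0_norm// (le_lt_trans c1)// (le_lt_trans (ler_norm _)).
Qed.

Lemma nsq_expi u : (nsq (expi u) < +oo)%E.
Proof.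
rewrite /nsq (_ : (fun x => _) = cst 1%E); last first.
  by apply/funext => x; rewrite expi_cis sqn_cis.
rewrite integral_cst//= mul1e.
by apply: (le_lt_trans (probability_le1 mu measurableT)); exact: ltry.
Qed.

(** Truncation: where |Re f| and |Im f| are at most n, f is a sum of bounded
    functions times constants, and the exponential of frequency 0 is 1. *)
Lemma approximable_L2 f : cmeasurable f -> (nsq f < +oo)%E -> approximable f.
Proof.
move=> mf ff; have [mRe mIm] := mf.
pose A n : set T := [set x | `|complex.Re (f x)| <= n%:R] `&` [set x | `|complex.Im (f x)| <= n%:R].
have mA n : measurable (A n).
  apply: measurableI.
    by have := measurable_preimage_itv `[- n%:R, n%:R] mRe;
       under eq_set do rewrite in_itv/= -ler_norml.
  by have := measurable_preimage_itv `[- n%:R, n%:R] mIm;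
     under eq_set do rewrite in_itv/= -ler_norml.
have m1 n : measurable_fun setT (\1_(A n) : T -> R) by exact: measurable_indic.
have n1 n (x : T) : `|\1_(A n) x : R| <= 1.
  by rewrite indicE; case: (_ \in _); rewrite ?normr1 ?normr0.
apply: approximable_closed => // e e0.
have [n ne] : exists n, (nsq (fun x => (1 - \1_(A n) x)%:C%C * f x)%R < e%:E)%E.
  apply: (@nsq_dominated f (fun n x => 1 - \1_(A n) x) 2) => //.
  - by move=> n; apply: measurable_funB.
  - by move=> n x; rewrite (le_trans (ler_normB _ _))// normr1 -[2]/(1 + 1) lerD2l.
  - move=> x; apply: cvg_near_cst.
    exists (maxn (Num.bound `|complex.Re (f x)|) (Num.bound `|complex.Im (f x)|)) => // n /=.
    rewrite geq_max => /andP[nr ni].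
    rewrite indicE mem_set ?subrr//; split; rewrite /= ltW//.
      by apply: lt_le_trans (archi_boundP (normr_ge0 _)) _; rewrite ler_nat.
    by apply: lt_le_trans (archi_boundP (normr_ge0 _)) _; rewrite ler_nat.
have mult (k : T -> R) : measurable_fun setT k ->
    (forall x, A n x -> `|k x| <= n%:R) -> multiplier (fun x => \1_(A n) x * k x).
  move=> mk kn; apply: multiplier_bounded; split; first exact: measurable_funM.
  exists n%:R => x; rewrite indicE; have [/set_mem/kn|_] := boolP (x \in A n).
    by rewrite mul1r.
  by rewrite mul0r normr0.
exists (fun x => (\1_(A n) x)%:C%C * f x); split.
- by apply: cmeasurableM => //; exact: cmeasurable_real.
- have -> : (fun x => (\1_(A n) x)%:C%C * f x) = (fun x =>
      (\1_(A n) x * complex.Re (f x))%:C%C * expi 0 x +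
      'i%C * ((\1_(A n) x * complex.Im (f x))%:C%C * expi 0 x)).
    apply/funext => x; rewrite expi_cis mul0r cis0 !mulr1.
    case: (f x) => u v; set w : R := \1_(A n) x.
    by congr Complex => /=; ring.
  have [b1 a1] := mult _ mRe (fun x Ax => Ax.1).
  have [b2 a2] := mult _ mIm (fun x Ax => Ax.2).
  have me := cmeasurable_expi 0.
  apply: approximableD.
  + exact: cmeasurable_mult.
  + by apply: cmeasurableZ; exact: cmeasurable_mult.
  + by apply: a1 => //; exact: nsq_expi.
  + by apply: approximableZ; [exact: cmeasurable_mult|apply: a2 => //; exact: nsq_expi].
- have -> : (fun x => f x - (\1_(A n) x)%:C%C * f x) = (fun x => (1 - \1_(A n) x)%:C%C * f x).
    by apply/funext => x; rewrite rmorphB mulrBl mul1r.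
  exact: ne.
Qed.

End closed_span.

(** * The identity of Bessel and spectra *)

Lemma fourierN (u : R) : fourier mu (- u) = conjc (fourier mu u).
Proof.
rewrite /fourier /cintegral /conjc; congr Complex.
  by apply: eq_Rintegral => x _; rewrite /expi/= mulrN mulNr cosN.
rewrite -mulN1r -RintegralZl//; last exact: (bounded_mfun_integrable mu (bounded_mfun_sin _)).
by apply: eq_Rintegral => x _; rewrite /expi/= mulrN mulNr sinN mulN1r.
Qed.

Lemma expi_mul_conj (u v x : R) : expi u x * conjc (expi v x) = expi (u - v) x.
Proof. by rewrite !expi_cis -cisN -cisD; congr cis; ring. Qed.

Lemma nsq_trig s : nsq (trig s) =
  (complex.Re (\sum_(p <- s) \sum_(p' <- s) p.2 * conjc p'.2 * fourier mu (p.1 - p'.1)))%:E.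
Proof.
pose g x := \sum_(p <- s) \sum_(p' <- s) (p.2 * conjc p'.2) * expi (p.1 - p'.1) x.
have bterm (p p' : R * R[i]) : cbounded (fun x => p.2 * conjc p'.2 * expi (p.1 - p'.1) x).
  by apply: cboundedM; [exact: cbounded_cst|exact: cbounded_expi].
have bg : cbounded g by do 2! apply: cbounded_sum => ?.
have -> : \sum_(p <- s) \sum_(p' <- s) p.2 * conjc p'.2 * fourier mu (p.1 - p'.1) =
    cintegral mu (g : T -> R[i]).
  rewrite /g cintegral_sum => [|p]; last exact: cbounded_sum.
  apply: eq_bigr => p _; rewrite cintegral_sum//; apply: eq_bigr => p' _.
  by rewrite cintegralZ//; exact: cbounded_expi.
have sqng x : sqn (trig s x) = complex.Re (g x).
  have := sqn_sum s (fun p => p.2 * expi p.1 x); rewrite /trig => h.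
  rewrite -[LHS]/(complex.Re (_%:C)%C) h /g; congr complex.Re.
  apply: eq_bigr => p _; apply: eq_bigr => p' _.
  by rewrite rmorphM/= -expi_mul_conj; ring.
rewrite /nsq /cintegral/= /Rintegral fineK.
  by apply: eq_integral => x _; rewrite sqng.
exact: (integrable_fin_num measurableT (bounded_mfun_integrable mu bg.1)).
Qed.

(** Expanding the square of the norm gives 1 plus the terms
    |c i|^2 - 2 Re (conj (c i) f i), with f i the Fourier coefficient; complete
    the squares. *)
Lemma nsq_bessel (s : seq R) (c : R -> R[i]) u : uniq s ->
  {in s &, forall i j, fourier mu (i - j) = (i == j)%:R} ->
  nsq (fun x => expi u x - \sum_(i <- s) c i * expi i x) =
  (1 - \sum_(i <- s) sqn (fourier mu (u - i)) +
   \sum_(i <- s) sqn (c i - fourier mu (u - i)))%:E.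
Proof.
move=> us orth.
pose l : seq (R * R[i]) := (u, 1) :: [seq (i, - c i) | i <- s].
have -> : (fun x => expi u x - \sum_(i <- s) c i * expi i x) = trig l.
  apply/funext => x; rewrite /trig big_cons big_map mul1r -sumrN.
  by congr (_ + _); apply: eq_bigr => i _; rewrite mulNr.
rewrite nsq_trig; congr EFin; rewrite big_cons big_cons !big_map/= subrr fourier0.
have -> : \sum_(i <- s) \sum_(p <- l) - c i * conjc p.2 * fourier mu (i - p.1) =
    \sum_(i <- s) (- c i * conjc (fourier mu (u - i)) + c i * conjc (c i)).
  rewrite big_seq [RHS]big_seq; apply: eq_bigr => i si.
  rewrite big_cons big_map/= conjc1 mulr1 -(opprB u) fourierN; congr (_ + _).
  rewrite (bigD1_seq i)//= orth// eqxx mulr1 rmorphN mulrNN.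
  rewrite big_seq_cond big1 ?addr0// => j /andP[sj ji].
  by rewrite orth// eq_sym (negPf ji) mulr0.
rewrite conjc1 !mulr1 -addrA -big_split/=.
rewrite (eq_bigr (fun i => (sqn (c i - fourier mu (u - i)) -
    sqn (fourier mu (u - i)))%:C%C)) => [|i _]; last first.
  by rewrite rmorphB/= !sqnE rmorphB/= rmorphN/=; ring.
by rewrite cReD -rmorph_sum/= sumrB; ring.
Qed.

Definition coef (s : seq (R * R[i])) (i : R) : R[i] := \sum_(p <- s | p.1 == i) p.2.

Lemma trig_coef s x :
  trig s x = \sum_(i <- undup [seq p.1 | p <- s]) coef s i * expi i x.
Proof.
rewrite /trig.
under [RHS]eq_bigr do rewrite big_distrl/=.
rewrite (exchange_big_dep predT)//= big_seq [RHS]big_seq; apply: eq_bigr => p ps.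
under eq_bigl do rewrite eq_sym.
by rewrite -big_filter filter_pred1_uniq ?undup_uniq ?mem_undup ?map_f// big_seq1.
Qed.

Lemma L2inner_expi (u v : R) : L2inner mu (expi u : T -> R[i]) (expi v : T -> R[i]) = fourier mu (u - v).
Proof. by rewrite /L2inner; congr cintegral; apply/funext => x; exact: expi_mul_conj. Qed.

Definition orthonormal_freqs (Lam : set R) :=
  forall i j, Lam i -> Lam j -> fourier mu (i - j) = (i == j)%:R.

Lemma in_L2_expi (u : R) : in_L2 mu (expi u : T -> R[i]).
Proof.
have [m1 m2] := cmeasurable_expi u.
by split => //; rewrite L2norm_lty nsq_expi.
Qed.

(** With the Fourier coefficients as c, the last sum of [nsq_bessel] vanishes. *)
Lemma spectrum_of_frame (Lam : set R) : countable Lam -> orthonormal_freqs Lam ->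
  (forall (u e : R), 0 < e -> exists s, [/\ uniq s, forall i, i \in s -> Lam i &
     1 - e < \sum_(i <- s) sqn (fourier mu (u - i))]) ->
  is_spectrum mu Lam.
Proof.
move=> cL oL frame; split => //.
have app u : approximable Lam (expi u).
  move=> e e0; have [s [us sL se]] := frame u e e0.
  exists [seq (i, fourier mu (u - i)) | i <- s]; split.
    by move=> p /mapP[i /sL ? ->].
  under [X in nsq X]eq_fun do rewrite /trig big_map/=.
  rewrite (nsq_bessel (fun i => fourier mu (u - i)))//; last first.
    by move=> i j /sL ? /sL ?; exact: oL.
  rewrite [X in _ + X]big1 => [|i _]; last by rewrite subrr /sqn/= expr0n/= addr0.
  by rewrite lte_fin addr0; lra.
split.
- by move=> u _; exact: in_L2_expi.
- by move=> i j Li Lj; rewrite L2inner_expi; exact: oL.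
- move=> f [m1 m2]; rewrite L2norm_lty => ff e e0.
  have [s [sL fs]] := approximable_L2 app (conj m1 m2) ff (exprn_gt0 2 e0).
  exists (undup [seq p.1 | p <- s]), (coef s); split.
    by move=> i; rewrite mem_undup => /mapP[p /sL ? ->].
  rewrite L2norm_lt//; move: fs.
  by under eq_fun do rewrite trig_coef.
Qed.

(** Whatever the coefficients, the last sum of [nsq_bessel] is nonnegative. *)
Lemma frame_of_spectrum (Lam : set R) : orthonormal_freqs Lam -> is_spectrum mu Lam ->
  forall (u e : R), 0 < e -> exists s, [/\ uniq s, forall i, i \in s -> Lam i &
     1 - e < \sum_(i <- s) sqn (fourier mu (u - i))].
Proof.
move=> oL [_ [_ _ dense]] u e e0.
have se0 : 0 < Num.sqrt e by rewrite sqrtr_gt0.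
have [s [c [sL]]] := dense _ (in_L2_expi u) _ se0.
rewrite L2norm_lt// sqr_sqrtr ?(ltW e0)//.
pose l := [seq (i, c i) | i <- s].
have lE x : \sum_(i <- s) c i * expi i x = \sum_(i <- undup [seq p.1 | p <- l]) coef l i * expi i x.
  by rewrite -trig_coef /trig big_map.
under eq_fun do rewrite lE.
set s' := undup _; have s'L i : i \in s' -> Lam i.
  by rewrite mem_undup => /mapP[p /mapP[j /sL ? ->] ->].
rewrite nsq_bessel ?undup_uniq//; last by move=> i j /s'L ? /s'L ?; exact: oL.
rewrite lte_fin => h; exists s'; split => //; first exact: undup_uniq.
have : 0 <= \sum_(i <- s') sqn (coef l i - fourier mu (u - i)).
  by apply: sumr_ge0 => *; exact: sqn_ge0.
by lra.
Qed.

End square_norm.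

(** * Words and q-adic expansions *)

Section words.
Variables (q : nat) (q_gt1 : (1 < q)%N).
Implicit Types (k n j : nat) (s : seq 'I_q).
Local Notation ord0q := (letter0 q_gt1).
Local Open Scope nat_scope.

Let q_gt0 : 0 < q := ltnW q_gt1.

Definition digit k j : 'I_q := Ordinal (ltn_pmod (k %/ q ^ j) q_gt0).
Definition num_digits k := if k == 0 then 0 else (trunc_log q k).+1.
Definition word_value s := \sum_(j < size s) nth ord0q s j * q ^ j.

Lemma digit_mod k n j : j < n -> digit (k %% q ^ n) j = digit k j.
Proof.
move=> jn; apply: val_inj => /=.
rewrite [in RHS](divn_eq k (q ^ n)) -{3}(subnK (ltnW jn)) expnD mulnA divnMDl ?expn_gt0 ?q_gt0//.
rewrite -[n - j]prednK ?subn_gt0// expnS mulnCA.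
by rewrite (mulnC q) modnMDl.
Qed.

Lemma eq_mod_digit k k' n j : k = k' %[mod q ^ n] -> j < n -> digit k j = digit k' j.
Proof. by move=> e jn; rewrite -(digit_mod k jn) e digit_mod. Qed.

Lemma digit_big k n j : k < q ^ n -> n <= j -> digit k j = ord0q.
Proof.
move=> kn nj; apply: val_inj => /=.
by rewrite divn_small ?mod0n// (leq_trans kn)// leq_pexp2l.
Qed.

Lemma sum_digits k n : \sum_(j < n) digit k j * q ^ j = k %% q ^ n.
Proof.
elim: n => [|n IH]; first by rewrite big_ord0 expn0 modn1.
rewrite big_ord_recr IH/= expnSr.
have qn0 : 0 < q ^ n by rewrite expn_gt0 q_gt0.
rewrite {3}(divn_eq k (q ^ n)) {2}(divn_eq (k %/ q ^ n) q) mulnDl -mulnA.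
rewrite (mulnC q) -addnA modnMDl [RHS]modn_small 1?addnC//.
have := ltn_pmod (k %/ q ^ n) q_gt0; have := ltn_pmod k qn0.
move: (k %% _) (_ %% q) => u v h1 h2.
apply: (@leq_trans (v.+1 * q ^ n)); first by rewrite mulSn ltn_add2r.
by rewrite mulnC leq_mul2l h2 orbT.
Qed.

Lemma digit_word_value s j : digit (word_value s) j = nth ord0q s j.
Proof.
rewrite /word_value.
elim: s j => [|a s IH] j.
  by rewrite big_ord0 nth_nil; apply: val_inj; rewrite /= div0n mod0n.
rewrite /= big_ord_recl/= expn0 muln1.
have -> : \sum_(i < size s) nth ord0q (a :: s) (bump 0 i) * q ^ bump 0 i =
    (\sum_(i < size s) nth ord0q s i * q ^ i) * q.
  by rewrite big_distrl; apply: eq_bigr => i _; rewrite /= expnSr mulnA.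
set v := \sum_(_ < _) _; case: j => [|j] /=; apply: val_inj => /=.
  by rewrite expn0 divn1 addnC modnMDl modn_small.
rewrite -[RHS]/(nat_of_ord (nth ord0q s j)) -IH /= expnS divnMA.
by rewrite addnC divnMDl// (divn_small (ltn_ord a)) addn0.
Qed.

Lemma num_digits_bounds k : 0 < k -> q ^ (num_digits k).-1 <= k < q ^ num_digits k.
Proof.
move=> k0; rewrite /num_digits -[k == 0]negbK -lt0n k0/=.
exact: (trunc_log_bounds q_gt1 k0).
Qed.

Lemma ltn_num_digits k : k < q ^ num_digits k.
Proof. by case: (posnP k) => [->|/num_digits_bounds/andP[]//]; rewrite expn_gt0 q_gt0. Qed.

Lemma num_digits_le k n : k < q ^ n -> num_digits k <= n.
Proof.
case: (posnP k) => [->//|k0 kn]; have /andP[h _] := num_digits_bounds k0.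
have := leq_ltn_trans h kn; rewrite ltn_exp2l//.
by rewrite /num_digits -[k == 0]negbK -lt0n k0.
Qed.

Lemma num_digits_eq k n : q ^ n <= k < q ^ n.+1 -> num_digits k = n.+1.
Proof.
move=> /andP[nk kn]; apply/eqP; rewrite eqn_leq num_digits_le//=.
by rewrite -(ltn_exp2l _ _ q_gt1); apply: leq_ltn_trans nk (ltn_num_digits k).
Qed.

Definition digit_word k : seq 'I_q := mkseq (digit k) (num_digits k).

Lemma digit_word_last k : last_nonzero q_gt1 (digit_word k).
Proof.
rewrite /last_nonzero /digit_word; case: (posnP k) => [->//|k0 _].
have /andP[h1 h2] := num_digits_bounds k0.
have nd : num_digits k = (num_digits k).-1.+1.
  by rewrite /num_digits -[k == 0]negbK -lt0n k0.
rewrite nd mkseqS last_rcons => /(congr1 val)/=.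
apply/eqP; rewrite modn_small -?lt0n ?divn_gt0 ?expn_gt0 ?q_gt0//.
by rewrite ltn_divLR ?expn_gt0 ?q_gt0// -expnS -nd.
Qed.

Lemma digit_word_pad k : pad0 q_gt1 (digit_word k) = digit k.
Proof.
apply/funext => j; rewrite /pad0 /digit_word.
have [jn|nj] := ltnP j (num_digits k); first by rewrite nth_mkseq.
by rewrite nth_default ?size_mkseq// (digit_big (ltn_num_digits k)).
Qed.

Lemma word_value_digit_word k : word_value (digit_word k) = k.
Proof.
rewrite /word_value size_mkseq -[RHS](modn_small (ltn_num_digits k)) -sum_digits.
by apply: eq_bigr => j _; rewrite nth_mkseq.
Qed.

(** A word whose last letter is not 0 has the least length among those with the
    same padding. *)
Lemma pad0_inj s s' : last_nonzero q_gt1 s -> last_nonzero q_gt1 s' ->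
  pad0 q_gt1 s = pad0 q_gt1 s' -> s = s'.
Proof.
have size_le u v : last_nonzero q_gt1 u -> pad0 q_gt1 u = pad0 q_gt1 v -> size u <= size v.
  move=> ul uv; rewrite leqNgt; apply/negP => vu.
  have un : u <> [::] by move=> u0; rewrite u0 in vu.
  apply: (ul un); rewrite -nth_last.
  have -> : nth ord0q u (size u).-1 = nth ord0q v (size u).-1.
    by have /(congr1 (fun f => f (size u).-1)) := uv.
  by rewrite nth_default// -ltnS prednK// (leq_ltn_trans _ vu).
move=> sl sl' e; apply: (@eq_from_nth _ ord0q).
  by apply/eqP; rewrite eqn_leq !size_le.
by move=> i _; have /(congr1 (fun f => f i)) := e.
Qed.

Lemma qadicE k : qadic q_gt1 k = digit_word k.
Proof.
apply: xget_unique.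
  by split; [exact: (esym (word_value_digit_word k))|exact: digit_word_last].
move=> s [kE sl]; apply: pad0_inj sl (@digit_word_last k) _.
apply/funext => j; rewrite digit_word_pad /pad0 -digit_word_value.
by rewrite /word_value -kE.
Qed.

Lemma GammaE : Gamma q_gt1 = range digit.
Proof.
apply/seteqP; split => [sigma [s sl <-]|_ [k _ <-]].
  exists (word_value s) => //; apply/funext => j.
  exact: digit_word_value.
by exists (digit_word k); [exact: digit_word_last|exact: digit_word_pad].
Qed.

Lemma digit_word_zeros k l : digit_word k ++ zeros q_gt1 l =
  prefix_word (digit k) (num_digits k + l).
Proof.
rewrite /digit_word /prefix_word /mkseq iotaD map_cat; congr (_ ++ _).
apply: (@eq_from_nth _ ord0q); rewrite size_nseq ?size_map ?size_iota// => j jl.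
rewrite nth_nseq jl (nth_map 0) ?size_iota// nth_iota//.
by rewrite (digit_big (ltn_num_digits k))// leq_addr.
Qed.

End words.

(** * Digits and counting functions of a regular mapping *)

Section regular.
Variables (q : nat) (q_gt1 : (1 < q)%N) (b : nat) (tau : seq 'I_q -> int).
Hypothesis tau_regular : regular_mapping q_gt1 b tau.
Let q_gt0 : (0 < q)%N := ltnW q_gt1.

Definition tau_digit k j : int := tau (prefix_word (digit q_gt1 k) j.+1).
Local Notation t := tau_digit.

Lemma tau_digit_mod k k' j : (k = k' %[mod q ^ j.+1])%N -> t k j = t k' j.
Proof.
move=> e; rewrite /t /prefix_word; congr tau; apply/eq_in_map => i.
by rewrite mem_iota => /andP[_ ij]; rewrite (eq_mod_digit _ e).
Qed.

Lemma tau_digit_residue k j :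
  exists m : int, t k j = ((k %/ q ^ j) %% q)%N%:Z + q%:Z * m.
Proof.
rewrite /t /prefix_word mkseqS.
by have [[m _ <-] _] := regular_digit tau_regular (mkseq (digit q_gt1 k) j) (digit q_gt1 k j); exists m.
Qed.

Lemma tau_digit_bound k j : -1 <= t k j <= b%:Z - 2.
Proof. exact: (regular_codomain tau_regular). Qed.

Lemma tau_digit0 j : t 0 j = 0.
Proof.
rewrite -(regular_zeros tau_regular (ltn0Sn j)); congr tau.
by have := digit_word_zeros q_gt1 0 j.+1.
Qed.

Lemma tau_digit_fin k : exists L, forall j, (L <= j)%N -> t k j = 0.
Proof.
have : Gamma q_gt1 (digit q_gt1 k) by rewrite GammaE; exists k.
move=> /(regular_Gamma tau_regular)[L _ hL]; exists L => j Lj.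
by apply: hL => /=; rewrite ltnW.
Qed.

Definition tau_length k : nat := projT1 (cid (tau_digit_fin k)).
Local Notation L := tau_length.

Lemma tau_digit_eq0 k j : (L k <= j)%N -> t k j = 0.
Proof. exact: (projT2 (cid (tau_digit_fin k))). Qed.

Lemma tau_zeros k l : (0 < num_digits q k + l)%N ->
  tau (digit_word q_gt1 k ++ zeros q_gt1 l) = t k (num_digits q k + l).-1.
Proof. by move=> h; rewrite digit_word_zeros /t prednK. Qed.

Lemma num_digits_gt0 k : (0 < k)%N -> (0 < num_digits q k)%N.
Proof. by move=> k0; rewrite /num_digits -[k == 0%N]negbK -lt0n k0. Qed.

(** By the residue condition, as the leading q-adic digit of k is not 0. *)
Lemma tau_digit_lead k : (0 < k)%N -> t k (num_digits q k).-1 != 0.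
Proof.
move=> k0; have [m ->] := tau_digit_residue k (num_digits q k).-1.
have /andP[h1 h2] := num_digits_bounds q_gt1 k0.
have nd := prednK (num_digits_gt0 k0).
have hq : (k %/ q ^ (num_digits q k).-1 < q)%N.
  by rewrite ltn_divLR ?expn_gt0 ?q_gt0// -expnS nd.
have h0 : (0 < k %/ q ^ (num_digits q k).-1)%N by rewrite divn_gt0// expn_gt0 q_gt0.
rewrite modn_small//; move: (_ %/ _)%N h0 hq => a a0 aq.
apply/eqP => /(congr1 (fun z => (z %% q%:Z)%Z)); rewrite mulrC addrC modzMDl mod0z.
by rewrite modz_nat modn_small// => -[e]; rewrite e in a0.
Qed.

(** The set that defines [Nlast] is not empty: tau takes a nonzero value on the
    expansion of k itself, and finitely many on its continuations by zeros. *)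
Lemma Nlast_spec k j : (0 < k)%N -> (Nlast q_gt1 tau k <= j)%N -> t k j = 0.
Proof.
move=> k0; rewrite /Nlast qadicE.
set n := size _; have nE : n = num_digits q k by rewrite /n size_mkseq.
have n0 : (0 < n)%N by rewrite nE num_digits_gt0.
pose P l := tau (digit_word q_gt1 k ++ zeros q_gt1 l) != 0.
have PE l : P l = (t k (n + l).-1 != 0) by rewrite /P tau_zeros -?nE// ltn_addr.
have exP : exists l, P l by exists 0%N; rewrite PE addn0 nE tau_digit_lead.
have leP l : P l -> (l <= L k)%N.
  rewrite PE leqNgt; apply: contraNN => Lkl.
  by rewrite tau_digit_eq0// -ltnS (prednK (ltn_addr _ n0)) (leq_trans Lkl)// leq_addl.
case: (ex_maxnP exP leP) => l Pl lmax.
have [| nN tN hN] := xgetPex 0%N (P := [set N | [/\ (n <= N)%N,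
    tau (digit_word q_gt1 k ++ zeros q_gt1 (N - n)) <> 0 &
    forall l, (N - n < l)%N -> tau (digit_word q_gt1 k ++ zeros q_gt1 l) = 0]]).
  exists (n + l)%N; split; first exact: leq_addr.
    by rewrite addKn; apply/eqP.
  rewrite addKn => l' ll'; apply/eqP; apply: contraT => /lmax.
  by rewrite leqNgt ll'.
move: (xget _ _) nN tN hN => N nN _ hN Nj.
have nj : (n <= j)%N := leq_trans nN Nj.
have := hN (j.+1 - n)%N; rewrite tau_zeros -?nE ?ltn_addr// subnKC ?leqW//=; apply.
by rewrite ltn_sub2r// ltnS.
Qed.

Lemma maxN_spec n k j : (k < q ^ n)%N -> (maxN q_gt1 tau n <= j)%N -> t k j = 0.
Proof.
move=> kn nj; have [->|k0] := posnP k; first exact: tau_digit0.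
apply: Nlast_spec => //; apply: leq_trans nj.
by apply: leq_bigmax_seq; rewrite // mem_index_iota k0.
Qed.

Lemma NstarE k : Nstar q_gt1 tau k =
  nonzero_digits (L k) (fun j => t k (num_digits q k + j)).
Proof.
rewrite /Nstar qadicE.
pose X := [seq l <- iota 1 (L k) | tau (digit_word q_gt1 k ++ zeros q_gt1 l) != 0].
have -> : [set l | (1 <= l)%N /\ tau (digit_word q_gt1 k ++ zeros q_gt1 l) <> 0] =
    [set` [fset x | x in X]%fset].
  apply/seteqP; split => l /=; rewrite inE /= mem_filter mem_iota.
    move=> [l1 /eqP tl]; rewrite tl l1 add1n ltnS /= leqNgt; apply/negP => Ll.
    move/negP: tl; apply; rewrite tau_zeros ?addn_gt0 ?l1 ?orbT// tau_digit_eq0//.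
    by rewrite -ltnS prednK ?addn_gt0 ?l1 ?orbT// (leq_trans Ll)// leq_addl.
  by move=> /andP[/eqP tl /andP[l1 _]].
rewrite set_fsetK card_fseq undup_id ?filter_uniq ?iota_uniq//.
rewrite size_filter -sum1_count big_mkcond/= /nonzero_digits.
rewrite -[in LHS](addn0 1%N) iotaDl big_map -{1}(subn0 (L k)) -/(index_iota 0 (L k)) big_mkord.
apply: eq_bigr => j _; rewrite tau_zeros ?addn_gt0 ?orbT//.
by rewrite add1n addnS/=; case: (_ != _).
Qed.

(** A tail from p on drops the nonzero digits between the length of the
    expansion of k and p. *)
Lemma tail_nonzeros_le p k : (k < q ^ p)%N ->
  (tail_nonzeros t L p k <= Nstar q_gt1 tau k)%N.
Proof.
move=> /(num_digits_le q_gt1) /subnKC kp; rewrite NstarE /tail_nonzeros -kp.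
set n := num_digits q k; set d := (p - n)%N.
rewrite /nonzero_digits.
apply: (@leq_trans (\sum_(j < d + L k) (t k (n + j)%N != 0))%N).
  rewrite [leqRHS]big_split_ord/= -[leqLHS]add0n leq_add//.
  by apply: leq_sum => j _; rewrite addnA.
rewrite addnC big_split_ord/= [X in (_ + X)%N]big1 ?addn0// => j _.
by rewrite tau_digit_eq0// addnCA leq_addr.
Qed.

Lemma tail_nonzeros_eq n k : (q ^ n <= k < q ^ n.+1)%N ->
  tail_nonzeros t L n.+1 k = Nstar q_gt1 tau k.
Proof. by move=> kn; rewrite NstarE (num_digits_eq q_gt1 kn). Qed.

Lemma Nstar_le_max m n k : (q ^ m <= k < q ^ n)%N ->
  (Nstar q_gt1 tau k <= maxNstar q_gt1 tau m n)%N.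
Proof. by move=> kmn; apply: leq_bigmax_seq; rewrite // mem_index_iota. Qed.

Lemma bigmin_leq (s : seq nat) (f : nat -> nat) z k : k \in s ->
  (\big[minn/z]_(i <- s) f i <= f k)%N.
Proof.
elim: s => // i s IH; rewrite inE big_cons => /orP[/eqP->|/IH]; first exact: geq_minl.
by move=> h; rewrite (leq_trans (geq_minr _ _)).
Qed.

Lemma min_le_Nstar n k : (q ^ n <= k < q ^ n.+1)%N ->
  (minNstar q_gt1 tau n <= Nstar q_gt1 tau k)%N.
Proof. by move=> kn; apply: bigmin_leq; rewrite mem_index_iota. Qed.

Section frequencies.
Variable R : realType.

Lemma Pi_tauE k : Pi_tau R b tau (digit q_gt1 k) = digit_sum R b (L k) (t k).
Proof.
rewrite /Pi_tau; apply: lim_near_cst => //.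
exists (L k) => // n /= Ln; rewrite /series/= (big_cat_nat (n := L k))//=.
rewrite [X in _ + X](_ : _ = 0) ?addr0 ?big_mkord//.
rewrite big_nat_cond big1// => j.
by rewrite andbT => /andP[Lj _]; rewrite -/(t k j) tau_digit_eq0// mul0r.
Qed.

Lemma Lambda_tauE (r : nat) : [set r%:R * l | l in Lambda_tau R q_gt1 b tau] =
  range (freq R r b t L).
Proof.
rewrite /Lambda_tau GammaE; apply/seteqP; split => [_ [_ [_ [k _ <-] <-] <-]|_ [k _ <-]].
  by exists k => //; rewrite Pi_tauE.
exists (Pi_tau R b tau (digit q_gt1 k)); last by rewrite Pi_tauE.
by exists (digit q_gt1 k) => //; exists k.
Qed.

End frequencies.
End regular.

(** * Series and finite sums *)

Section series.
Variables (R : realType) (u : nat -> R).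
Hypothesis u_ge0 : forall n, 0 <= u n.

Lemma nneseries_le_bound (C : R) : (forall N, \sum_(1 <= n < N) u n <= C) ->
  (\sum_(1 <= n <oo) (u n)%:E <= C%:E)%E.
Proof.
move=> uC; apply: lime_le.
  by apply: is_cvg_nneseries => n _ _; rewrite lee_fin.
by apply: nearW => N; rewrite sumEFin lee_fin.
Qed.

(** Partial sums come within e of the total, by [nneseries_le_bound]. *)
Lemma nneseries_tail_small (e : R) : (\sum_(1 <= n <oo) (u n)%:E < +oo)%E -> 0 < e ->
  exists n0, forall N, \sum_(n0 <= n < N) u n <= e.
Proof.
move=> fin e0.
have u0 n : (1 <= n)%N -> xpredT n -> (0 <= (u n)%:E)%E by move=> _ _; rewrite lee_fin.
have S0 : (0 <= \sum_(1 <= n <oo) (u n)%:E)%E.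
  by apply: le_trans (nneseries_lim_ge 1 u0); rewrite big_geq.
have part N : ((\sum_(1 <= n < N) u n)%:E <= \sum_(1 <= n <oo) (u n)%:E)%E.
  by rewrite -sumEFin; exact: nneseries_lim_ge.
have := nneseries_le_bound.
move: part fin S0; case: (limn _) => [s||]// part _ _ bound.
have [N0 hN0] : exists N0, s - e < \sum_(1 <= n < N0) u n.
  apply/not_existsP => no.
  have := bound (s - e) (fun N => _); rewrite lee_fin => h.
  suff : s <= s - e by lra.
  by apply: h => N; rewrite leNgt; apply/negP.
exists (maxn 1 N0) => N.
have [Nle|/ltnW ltN] := leqP N (maxn 1 N0); first by rewrite big_geq// ltW.
have := part N; rewrite lee_fin (big_cat_nat (n := maxn 1 N0))//= ?leq_maxl// => h.
have : \sum_(1 <= n < N0) u n <= \sum_(1 <= n < maxn 1 N0) u n.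
  have [N01|N01] := leqP N0 1; first by rewrite big_geq// sumr_ge0.
  exact: lexx.
lra.
Qed.

Lemma sum_uniq_le (ks : seq nat) n : uniq ks -> (forall k, k \in ks -> (k < n)%N) ->
  \sum_(k <- ks) u k <= \sum_(0 <= k < n) u k.
Proof.
move=> uks ksn.
have ks_perm : perm_eq ks [seq k <- index_iota 0 n | k \in ks].
  apply: uniq_perm => //; first by rewrite filter_uniq ?iota_uniq.
  move=> k; rewrite mem_filter mem_index_iota /=.
  by have [/ksn->|] := boolP (k \in ks).
rewrite (perm_big _ ks_perm) big_filter [leRHS](bigID (fun k => k \in ks))/= lerDl.
exact: sumr_ge0.
Qed.

End series.

(** * Spectrality of the frequency set *)

Theorem theorem2p7 (R : realType) (q r b : nat) (q_gt1 : (1 < q)%N)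
    (r_gt1 : (1 < r)%N) (b_def : b = (q * r)%N)
    (mu : probability (measurableTypeR R) R)
    (mu_cantor : is_cantor_measure q b mu)
    (tau : seq 'I_q -> int) (tau_regular : regular_mapping q_gt1 b tau)
    (Lambda : set R)
    (Lambda_def : Lambda = [set r%:R * l | l in Lambda_tau R q_gt1 b tau]) :
  exists c1 c2 : R, [/\ 0 < c1, c1 < c2, c2 < 1,
    (* (i) *)
    (exists alpha : nat -> nat,
      [/\ forall n, (1 <= n)%N -> (0 < alpha n)%N,
          forall n, (1 <= n)%N -> (alpha n < alpha n.+1)%N,
          ((alpha n.+1)%:R - (maxN q_gt1 tau (alpha n))%:R : R)
            @[n --> \oo] --> +oo &
          (\sum_(1 <= n <oo)
            (c1 ^+ maxNstar q_gt1 tau (alpha n) (alpha n.+1))%:E)%E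
          = +oo%E]) ->
    is_spectrum mu Lambda &
    (* (ii) *)
    (\sum_(1 <= n <oo) (c2 ^+ minNstar q_gt1 tau n)%:E < +oo)%E ->
    ~ is_spectrum mu Lambda].
Proof.
pose G y := sqn (mask_poly q y : R[i]).
pose F x := sqn (fourier mu x).
pose t := tau_digit q_gt1 tau.
pose L := tau_length tau_regular.
pose lam := freq R r b t L.
have G_shift y : G (y + 1) = G y by exact: mask_shift.
have G_sum y : \sum_(i < q) G (y + i%:R / q%:R) = 1 by exact: mask_sum.
have G_ge0 y : 0 <= G y by exact: sqn_ge0.
have G_gt0 y : `|y| < q%:R^-1 -> 0 < G y by exact: mask_gt0.
have G_cont : continuous G := @mask_continuous R q.
have FG x : F x = G (x / b%:R) * F (x / b%:R).
  by rewrite /F (fourier_self_similar q_gt1 mu_cantor) sqnM.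
have F_cont : continuous F := @fourier_continuous R mu.
have F_ge0 x : 0 <= F x by exact: sqn_ge0.
have F0 : F 0 = 1 by rewrite /F fourier0 /sqn/= expr0n/= expr1n addr0.
have F_le1 x : F x <= 1.
  have := nsq_ge0 mu (fun y => expi x y - \sum_(i <- [:: 0]) fourier mu (x - i) * expi i y).
  rewrite nsq_bessel//; last first.
    by move=> i j; rewrite !inE => /eqP-> /eqP->; rewrite subrr fourier0 eqxx.
  rewrite !big_seq1 subrr subr0 lee_fin /F; set z := sqn (fourier _ _).
  by rewrite /sqn/= expr0n/= addr0 addr0 subr_ge0.
have F_even x : F (- x) = F x by rewrite /F fourierN sqn_conj.
have t_mod := @tau_digit_mod q q_gt1 tau.
have t_digit := tau_digit_residue tau_regular.
have t_bound := tau_digit_bound tau_regular.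
have t_fin := @tau_digit_eq0 _ _ _ _ tau_regular.
have t0 := tau_digit0 tau_regular.
have LamE : Lambda = range lam by rewrite Lambda_def (Lambda_tauE tau_regular).
have orth k l : k != l -> F (lam k - lam l) = 0.
  by move=> kl; apply: (@freq_orthogonal R q r b G F) => //; exact: t_bound.
have lam_inj : injective lam.
  move=> k l e; apply/eqP; apply: contraT => /orth.
  by rewrite e subrr F0 => /eqP; rewrite oner_eq0.
have oLam : orthonormal_freqs mu Lambda.
  rewrite LamE => _ _ [k _ <-] [l _ <-]; rewrite (inj_eq lam_inj).
  have [->|kl] := eqVneq k l; first by rewrite subrr fourier0.
  by apply: sqn_eq0; exact: orth.
have cLam : countable Lambda by rewrite LamE; apply: sub_countable (card_image_le _ _) _.
have [c c_gt0 F_ge] : exists2 c : R, 0 < c & forall x, `|x| <= core_radius R r b -> c <= F x.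
  exact: (@exists_F_lower_bound R q r b G F).
have [c' c'_lt1 G_le] : exists2 c : R, c < 1 &
    forall y, gap R q b <= y <= q%:R^-1 - gap R q b -> G y <= c.
  exact: (@exists_weight_upper_bound R q r b G).
(* The constants 1/4 and 1/2 ensure c1 < c2. *)
pose c1 := Num.min c 4^-1; pose c2 := Num.max c' 2^-1.
have c1_gt0 : 0 < c1 by rewrite lt_min c_gt0 invr_gt0 ltr0n.
have c1_le : c1 <= c by rewrite ge_min lexx.
have c2_lt1 : c2 < 1 by rewrite gt_max c'_lt1; lra.
have c2_ge : 2^-1 <= c2 by rewrite le_max lexx orbT.
have c2_G y : gap R q b <= y <= q%:R^-1 - gap R q b -> G y <= c2.
  by move=> /G_le h; rewrite le_max h.
exists c1, c2; split => //.
- by apply: lt_le_trans c2_ge; rewrite gt_min; apply/orP; right; lra.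
- move=> [al [_ al_mono al_far al_sum]].
  apply: spectrum_of_frame => // x e e0.
  apply: contrapT => no.
  (* F is even, so the sum of the F (x - lambda) is the frame sum at - x. *)
  have frame_le n : frame_sum q r b F t L n (- x) <= 1 - e.
    rewrite leNgt; apply/negP => h; apply: no.
    exists [seq lam k | k <- index_iota 0 (q ^ n)]; split.
    + by rewrite map_inj_uniq// iota_uniq.
    + by move=> i /mapP[k _ ->]; rewrite LamE; exists k.
    + rewrite big_map; apply: lt_le_trans h _; apply: ler_sum => k _.
      by rewrite -[leLHS]F_even opprD opprK.
  have far K : exists n1, forall n, (n1 <= n)%N -> (maxN q_gt1 tau (al n) + K <= al n.+1)%N.
    move/cvgryPge : al_far => /(_ K%:R)[n1 _ hn1]; exists n1 => n /hn1 /=.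
    by rewrite lerBrDr -natrD ler_nat addnC.
  have [C hC] : exists C, forall N,
      \sum_(1 <= n < N) c1 ^+ maxNstar q_gt1 tau (al n) (al n.+1) <= C.
    apply: (@weights_summable R q r b G F _ _ _ _ _ _ _ _ _ _ _ t L _ _ _ _
      c c1 e (- x) al (fun n => maxN q_gt1 tau (al n))) => //.
    + by move=> n k j _ kn; exact: (maxN_spec tau_regular kn).
    + move=> n k _ kn; apply: leq_trans (Nstar_le_max _ _ kn).
      by have /andP[_] := kn; exact: tail_nonzeros_le.
  have := nneseries_le_bound (fun n => exprn_ge0 _ (ltW c1_gt0)) hC.
  by rewrite al_sum.
- move=> sum_fin spec.
  have c2_ge0 : 0 <= c2 by apply: le_trans c2_ge; rewrite invr_ge0.
  have [n0 hn0] : exists n0, forall N, \sum_(n0 <= n < N) c2 ^+ minNstar q_gt1 tau n <= 2^-1.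
    by apply: nneseries_tail_small => // n; rewrite exprn_ge0.
  have [d d0 hd] : exists2 d : R, 0 < d & forall n, frame_sum q r b F t L n b%:R^-1 <= 1 - d.
    apply: (@frame_sum_gap R q r b G F _ _ _ _ _ _ _ _ _ _ t L _ _ _ _ _ c2
      (minNstar q_gt1 tau) _ _ _ _ n0 hn0) => //.
    by move=> n k kn; rewrite (tail_nonzeros_eq tau_regular kn); exact: min_le_Nstar.
  have [s [us sL]] := frame_of_spectrum oLam spec (- b%:R^-1) d0.
  apply/negP; rewrite -leNgt.
  have [ks sE] : exists ks, s = [seq lam k | k <- ks].
    elim: s {us} sL => [|i s IH] sL; first by exists [::].
    have [|ks ->] := IH; first by move=> j js; apply: sL; rewrite inE js orbT.
    have := sL i (mem_head _ _); rewrite LamE => -[k _ <-].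
    by exists (k :: ks).
  have uks : uniq ks by move: us; rewrite sE map_inj_uniq.
  pose N := \max_(k <- ks) k.
  apply: le_trans (hd N.+1); rewrite sE big_map.
  apply: le_trans (_ : \sum_(k <- ks) F (b%:R^-1 + lam k) <= _).
    by apply: ler_sum => k _; rewrite -opprD -/(F _) F_even.
  apply: (sum_uniq_le (u := fun k => F (b%:R^-1 + lam k))) => // k kks.
  apply: leq_trans (ltn_expl _ q_gt1); rewrite ltnS ltnW// ltnS.
  exact: leq_bigmax_seq.
Qed.
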